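(* Let $X\subset\mathbb{R}^n$ be a nonempty compact convex semialgebraic set and let $f\in\mathbb{R}[x_1,\ldots,x_n]$ be positive on $X$. Let $N$ be a positive integer and $\mu>0$ such that for every $\xi\in X$ the function $$\varphi_{N,\xi}(x)=(1+|x-\xi|^2)^Nf(x)$$ is $\mu$-strongly convex on $X$. Choose an arbitrary $a_0\in X$ and define inductively $$a_\nu=\operatorname{argmin}_X\,\varphi_{N,a_{\nu-1}},\qquad \nu=1,2,\ldots$$ Then the limit $a^*=\lim_{\nu\to\infty}a_\nu$ exists, and $a^*$ is a lower critical point of $f$ on $X$.
   Context: $\mu$-strong convexity of a $C^1$ function $\varphi$ on a convex set $X$ means $\varphi(y)\ge\varphi(x)+\langle y-x,\nabla\varphi(x)\rangle+\frac{\mu}{2}|y-x|^2$ for all $x,y\in X$. For a strongly convex function $\varphi$ on a nonempty compact convex set $X$, $\operatorname{argmin}_X\varphi$ denotes the unique point of $X$ at which $\varphi$ attains its minimum on $X$. A point $a\in X$ is a lower critical point of $f$ on $X$ if $\langle\nabla f(a),x-a\rangle\ge 0$ for all $x\in X$ in some neighbourhood of $a$. *)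

(* Defs.v *)
From HB Require Import structures.
From mathcomp Require Import all_boot all_order all_algebra.
From mathcomp Require Import all_classical all_reals all_analysis.
(* The notations of [mpoly] clash with those of [all_analysis]. *)
From mathcomp Require Import -(notations) mpoly.

Set Implicit Arguments.
Unset Strict Implicit.
Unset Printing Implicit Defensive.

Import Order.TTheory GRing.Theory Num.Theory.
Import numFieldNormedType.Exports.

Local Open Scope classical_set_scope.
Local Open Scope ring_scope.

(* The library norm on ['rV[R]_n] is the sup norm, hence an explicit inner
   product; both norms induce the topology of the library. *)
Definition dotv (R : realType) (n : nat) (u v : 'rV[R]_n) : R :=
  \sum_(i < n) u ord0 i * v ord0 i.

Definition sqnorm (R : realType) (n : nat) (u : 'rV[R]_n) : R := dotv u u.

Definition grad (R : realType) (n : nat) (phi : 'rV[R]_n -> R) (x : 'rV[R]_n) :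
    'rV[R]_n :=
  \row_(i < n) 'D_(delta_mx ord0 i) phi x.

Definition polyfun (R : realType) (n : nat) (p : mpoly n R)
    (x : 'rV[R]_n) : R :=
  meval (x ord0) p.

(* Finite unions of sets given by finitely many polynomial equations (first
   component) and strict polynomial inequalities (second component). *)
Definition semialgebraic (R : realType) (n : nat) (X : set 'rV[R]_n) : Prop :=
  exists S : seq (seq (mpoly n R) * seq (mpoly n R)),
    X = [set x : 'rV[R]_n |
      exists2 C : seq (mpoly n R) * seq (mpoly n R), C \in S &
        (forall p, p \in C.1 -> polyfun p x = 0) /\
        (forall q, q \in C.2 -> 0 < polyfun q x)].

Definition strongly_convex (R : realType) (n : nat) (mu : R)
    (X : set 'rV[R]_n) (phi : 'rV[R]_n -> R) : Prop :=
  forall x y, X x -> X y ->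
    phi x + dotv (y - x) (grad phi x) + mu / 2 * sqnorm (y - x) <= phi y.

(* The value 0 is only a default for when [phi] has no minimizer on [X]. *)
Definition argmin (R : realType) (n : nat) (X : set 'rV[R]_n)
    (phi : 'rV[R]_n -> R) : 'rV[R]_n :=
  xget 0 [set a | X a /\ forall x, X x -> phi a <= phi x].

Definition lower_critical (R : realType) (n : nat) (X : set 'rV[R]_n)
    (f : 'rV[R]_n -> R) (a : 'rV[R]_n) : Prop :=
  X a /\ \forall x \near a, X x -> 0 <= dotv (grad f a) (x - a).

Definition convexified (R : realType) (n : nat) (f : 'rV[R]_n -> R) (N : nat)
    (xi x : 'rV[R]_n) : R :=
  (1 + sqnorm (x - xi)) ^+ N * f x.

Definition argmin_iter (R : realType) (n : nat) (X : set 'rV[R]_n)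
    (f : 'rV[R]_n -> R) (N : nat) (a0 : 'rV[R]_n) (nu : nat) : 'rV[R]_n :=
  iter nu (fun a => argmin X (convexified f N a)) a0.

(* Main.v *)
(* The iterates decrease [f], with
     [f a_k - f a_(k+1) >= m |a_(k+1) - a_k|^2]    where [m := min_X f > 0],
   and minimality of [a_(k+1)] bounds the slope of [f] at [a_(k+1)] relative to
   [X], up to a quadratic term, by [C |a_(k+1) - a_k|]. Convergence is then a
   matter of a Kurdyka-Lojasiewicz inequality for [f] on [X], at the level
   [c := lim f a_k]. Quantifier elimination over real closed fields makes
   definable functions of one variable monotone near [0]. Choosing definably,
   for each small [t], a point of [X] of minimal slope on the level [c + t]
   gives a curve with monotone coordinates, hence of finite length, along which
   [f] varies at most like the slope times the length; so the length of the
   curve desingularizes [f] and the length of the sequence is finite. The limit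
   [l] minimizes [(1 + |x - l|^2)^N f x] over [X], and this function has the same
   gradient at [l] as [f]. *)
Require Import Defs.
From HB Require Import structures.
From mathcomp Require Import all_boot all_order all_algebra.
From mathcomp Require Import all_classical all_reals all_analysis.
From mathcomp Require Import -(notations) mpoly.
From mathcomp Require Import ring lra polyrcf.
From mathcomp Require ordered_qelim qe_rcf.

Set Implicit Arguments.
Unset Strict Implicit.
Unset Printing Implicit Defensive.

Import Order.TTheory GRing.Theory Num.Theory.
Import numFieldNormedType.Exports.

Local Open Scope classical_set_scope.
Local Open Scope ring_scope.

(** * Definable predicates *)

(** The selected curve may jump, so the argument is free of derivatives. Its only regularity is that
    the coordinates are monotone: their sum, with signs chosen to make each term nondecreasing, is
    bounded, and its increments dominate the sup norm of the chords. The length is measured by this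
    sum. The slope is proximal: one inequality for each competitor [z] in [X]. It is first-order
    expressible, closed in the pair (slope, point), and it can be applied between two points of the
    curve however far apart they are. The price is a quadratic remainder, which subdividing the
    interval of levels removes. Slopes are capped at 1 to keep the families compact; the slopes at
    the iterates tend to 0, so the cap is eventually satisfied. Quantifier elimination enters
    through one fact: a definable subset of the line contains, or misses, a whole one-sided
    neighbourhood of each point. Limits, monotonicity, and nonemptiness of all small levels from
    nonemptiness of arbitrarily small ones are drawn from it. *)

Definition polynomial_term (R : realType) (g : (nat -> R) -> R) : Prop :=
  exists2 t : GRing.term R, GRing.rterm t &
    forall s : seq R, GRing.eval s t = g (nth 0 s).

(* [P] is a predicate on the values [e i] of the variables; only valuations with
   finite support matter. *)
Definition definable (R : realType) (P : (nat -> R) -> Prop) : Prop :=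
  exists2 F : ordered_qelim.ord.formula R, ordered_qelim.ord.rformula F &
    forall s : seq R, ordered_qelim.ord.holds s F <-> P (nth 0 s).

Definition upd (R : Type) (e : nat -> R) (i : nat) (x : R) : nat -> R :=
  fun j => if j == i then x else e j.

Definition vec (R : Type) (n : nat) (e : nat -> R) (k : nat) : 'rV[R]_n :=
  \row_(i < n) e (k + i)%N.

Definition updv (R : Type) (n : nat) (e : nat -> R) (k : nat) (v : 'rV[R]_n) :
    nat -> R :=
  fun j => if (k <= j)%N then
             if insub (j - k)%N is Some i then v ord0 i else e j
           else e j.

Section Definability.

Variable R : realType.
Implicit Types (g h : (nat -> R) -> R) (P Q : (nat -> R) -> Prop).

Lemma nth_set_nth_upd (s : seq R) i x : nth 0 (set_nth 0 s i x) = upd (nth 0 s) i x.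
Proof. by apply/funext => j; rewrite nth_set_nth. Qed.

Lemma polynomial_term_const (c : R) : polynomial_term (fun=> c).
Proof. by exists (GRing.Const c). Qed.

Lemma polynomial_term_var i : polynomial_term (fun e : nat -> R => e i).
Proof. by exists (GRing.Var R i). Qed.

Lemma polynomial_termD g h : polynomial_term g -> polynomial_term h ->
  polynomial_term (fun e => g e + h e).
Proof.
move=> [t rt tg] [u ru uh]; exists (GRing.Add t u) => [|s] /=; first exact/andP.
by rewrite tg uh.
Qed.

Lemma polynomial_termM g h : polynomial_term g -> polynomial_term h ->
  polynomial_term (fun e => g e * h e).
Proof.
move=> [t rt tg] [u ru uh]; exists (GRing.Mul t u) => [|s] /=; first exact/andP.
by rewrite tg uh.
Qed.

Lemma polynomial_termN g : polynomial_term g -> polynomial_term (fun e => - g e).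
Proof. by move=> [t rt tg]; exists (GRing.Opp t) => //= s; rewrite tg. Qed.

Lemma polynomial_termB g h : polynomial_term g -> polynomial_term h ->
  polynomial_term (fun e => g e - h e).
Proof. by move=> pg ph; apply/polynomial_termD/polynomial_termN. Qed.

Lemma polynomial_termX g k : polynomial_term g -> polynomial_term (fun e => g e ^+ k).
Proof. by move=> [t rt tg]; exists (GRing.Exp t k) => //= s; rewrite tg. Qed.

Lemma polynomial_term_sum (I : Type) (r : seq I) (G : I -> (nat -> R) -> R) :
  (forall i, polynomial_term (G i)) -> polynomial_term (fun e => \sum_(i <- r) G i e).
Proof.
move=> pG; elim: r => [|i r IH].
  by under eq_fun do rewrite big_nil; exact: polynomial_term_const.
by under eq_fun do rewrite big_cons; exact: polynomial_termD.
Qed.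

Lemma polynomial_term_prod (I : Type) (r : seq I) (G : I -> (nat -> R) -> R) :
  (forall i, polynomial_term (G i)) -> polynomial_term (fun e => \prod_(i <- r) G i e).
Proof.
move=> pG; elim: r => [|i r IH].
  by under eq_fun do rewrite big_nil; exact: polynomial_term_const.
by under eq_fun do rewrite big_cons; exact: polynomial_termM.
Qed.

Lemma polynomial_term_polyfun n (p : mpoly n R) k :
  polynomial_term (fun e => polyfun p (vec n e k)).
Proof.
rewrite /polyfun; under eq_fun do rewrite mevalE.
apply: polynomial_term_sum => m; apply: polynomial_termM; first exact: polynomial_term_const.
apply: polynomial_term_prod => i; apply: polynomial_termX.
by under eq_fun do rewrite mxE; exact: polynomial_term_var.
Qed.

Lemma eq_definable P Q : (forall e, P e <-> Q e) -> definable P -> definable Q.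
Proof. by move=> PQ [F rF FP]; exists F => // s; rewrite FP PQ. Qed.

Lemma definable_le g h : polynomial_term g -> polynomial_term h ->
  definable (fun e => g e <= h e).
Proof.
move=> [t rt tg] [u ru uh]; exists (ordered_qelim.ord.Le t u) => [|s] /=; first exact/andP.
by rewrite tg uh.
Qed.

Lemma definable_not P : definable P -> definable (fun e => ~ P e).
Proof. by move=> [F rF FP]; exists (ordered_qelim.ord.Not F) => //= s; rewrite FP. Qed.

Lemma definable_and P Q : definable P -> definable Q -> definable (fun e => P e /\ Q e).
Proof.
move=> [F rF FP] [G rG GQ]; exists (ordered_qelim.ord.And F G) => [|s] /=; first exact/andP.
by rewrite FP GQ.
Qed.

Lemma definable_or P Q : definable P -> definable Q -> definable (fun e => P e \/ Q e).
Proof.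
move=> [F rF FP] [G rG GQ]; exists (ordered_qelim.ord.Or F G) => [|s] /=; first exact/andP.
by rewrite FP GQ.
Qed.

Lemma definable_imp P Q : definable P -> definable Q -> definable (fun e => P e -> Q e).
Proof.
move=> [F rF FP] [G rG GQ]; exists (ordered_qelim.ord.Implies F G) => [|s] /=; first exact/andP.
by rewrite FP GQ.
Qed.

Lemma definable_bool (b : bool) : definable (fun _ : nat -> R => b).
Proof. by exists (ordered_qelim.ord.Bool b). Qed.

Lemma definable_lt g h : polynomial_term g -> polynomial_term h ->
  definable (fun e => g e < h e).
Proof.
move=> pg ph; apply: (eq_definable _ (definable_not (definable_le ph pg))) => e.
by rewrite ltNge; split=> /negP.
Qed.

Lemma definable_eq g h : polynomial_term g -> polynomial_term h ->
  definable (fun e => g e = h e).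
Proof.
move=> [t rt tg] [u ru uh]; exists (ordered_qelim.ord.Equal t u) => [|s] /=; first exact/andP.
by rewrite tg uh.
Qed.

Lemma definable_ex i P : definable P -> definable (fun e => exists x, P (upd e i x)).
Proof.
move=> [F rF FP]; exists (ordered_qelim.ord.Exists i F) => //= s.
by split=> -[x Px]; exists x; move: Px; rewrite FP nth_set_nth_upd.
Qed.

Lemma definable_all i P : definable P -> definable (fun e => forall x, P (upd e i x)).
Proof.
move=> [F rF FP]; exists (ordered_qelim.ord.Forall i F) => //= s.
by split=> Px x; move: (Px x); rewrite FP nth_set_nth_upd.
Qed.

Lemma definable_all_seq (I : eqType) (r : seq I) (Q : I -> (nat -> R) -> Prop) :
  (forall i, definable (Q i)) -> definable (fun e => forall i, i \in r -> Q i e).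
Proof.
move=> dQ; elim: r => [|i r IH]; first by apply: eq_definable (definable_bool true) => e; split.
apply: eq_definable (definable_and (dQ i) IH) => e; split=> [[Qi Qr] j|QQ].
  by rewrite in_cons => /predU1P[->//|/Qr].
by split=> [|j jr]; apply: QQ; rewrite in_cons ?eqxx ?jr ?orbT.
Qed.

Lemma definable_ex_seq (I : eqType) (r : seq I) (Q : I -> (nat -> R) -> Prop) :
  (forall i, definable (Q i)) -> definable (fun e => exists2 i, i \in r & Q i e).
Proof.
move=> dQ; elim: r => [|i r IH].
  by apply: eq_definable (definable_bool false) => e; split=> // -[].
apply: eq_definable (definable_or (dQ i) IH) => e; split=> [[Qi|[j jr Qj]]|[j]].
- by exists i; rewrite ?in_cons ?eqxx.
- by exists j; rewrite ?in_cons ?jr ?orbT.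
- by rewrite in_cons => /predU1P[->|jr Qj]; [left|right; exists j].
Qed.

Lemma vec_updv n e k (v : 'rV[R]_n) : vec n (updv e k v) k = v.
Proof.
apply/rowP => i; rewrite mxE /updv leq_addr addKn.
by case: insubP => [j _ ji|]; [congr (v _ _); exact: val_inj|rewrite ltn_ord].
Qed.

Lemma updv_lt n e k (v : 'rV[R]_n) j : (j < k)%N -> updv e k v j = e j.
Proof. by move=> jk; rewrite /updv leqNgt jk. Qed.

Lemma vec_updv_lt n m e k (v : 'rV[R]_n) j :
  (j + m <= k)%N -> vec m (updv e k v) j = vec m e j.
Proof.
move=> jk; apply/rowP => i; rewrite !mxE updv_lt//.
by apply: leq_trans jk; rewrite ltn_add2l.
Qed.

(** Describing the block by valuations that agree with [e] outside it lets the induction remove one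
    variable at a time, before any vector appears. *)
Lemma definable_ex_block k n P : definable P ->
  definable (fun e => exists2 e', (forall j, ~~ (k <= j < k + n)%N -> e' j = e j) & P e').
Proof.
elim: n k P => [|n IH] k P dP.
  apply: eq_definable dP => e; split=> [Pe|[e' ee']]; first by exists e.
  suff -> : e' = e by [].
  by apply/funext => j; apply: ee'; rewrite addn0 ltnNge andbN.
apply: eq_definable (definable_ex k (IH k.+1 _ dP)) => e; split.
- move=> [x [e' ee' Pe']]; exists e' => // j jk.
  have jNk : j != k by apply: contraNneq jk => ->; rewrite leqnn addnS ltnS leq_addr.
  rewrite ee' /upd ?(negbTE jNk)//; apply: contraNN jk => /andP[kj].
  by rewrite (ltnW kj) addSnnS.
- move=> [e' ee' Pe']; exists (e' k); exists e' => // j jk; rewrite /upd.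
  have [->//|jNk] := eqVneq j k; apply: ee'; apply: contraNN jk => /andP[kj jn].
  by rewrite addSnnS jn andbT ltn_neqAle eq_sym jNk.
Qed.

Lemma definable_exv k n P : definable P ->
  definable (fun e => exists v : 'rV[R]_n, P (updv e k v)).
Proof.
move=> dP; apply: eq_definable (definable_ex_block k n dP) => e; split.
- move=> [e' ee' Pe']; exists (vec n e' k); suff -> : updv e k (vec n e' k) = e' by [].
  apply/funext => j; rewrite /updv; have [kj|jk] := leqP k j; last first.
    by rewrite ee'// negb_and -ltnNge jk.
  case: insubP => [i _ ij|]; first by rewrite mxE ij subnKC.
  by rewrite ltn_subLR// => jn; rewrite ee'// (negbTE jn) andbF.
- move=> [v Pv]; exists (updv e k v) => // j jk; rewrite /updv.
  case: ifP => // kj; case: insubP => // i; rewrite ltn_subLR// => jn.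
  by move: jk; rewrite kj jn.
Qed.

Lemma definable_allv k n P : definable P ->
  definable (fun e => forall v : 'rV[R]_n, P (updv e k v)).
Proof.
move=> dP; have := definable_not (definable_exv k n (definable_not dP)).
apply: eq_definable => e; split=> [nP v|Pv [v]]; last exact.
by apply: contrapT => nPv; apply: nP; exists v.
Qed.

Lemma definable_semialgebraic n (X : set 'rV[R]_n) k :
  semialgebraic X -> definable (fun e => X (vec n e k)).
Proof.
move=> [S ->] /=; apply: definable_ex_seq => C; apply: definable_and.
  apply: definable_all_seq => p; apply: definable_eq; first exact: polynomial_term_polyfun.
  exact: polynomial_term_const.
apply: definable_all_seq => p; apply: definable_lt; first exact: polynomial_term_const.
exact: polynomial_term_polyfun.
Qed.

End Definability.

(** * One-sided germs of definable sets on the line *)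

Section Germs.

Variable R : realType.

Lemma sg_horner_at_right (p : {poly R}) (x : R) :
  exists c, \forall t \near x^'+, Num.sg p.[t] = c.
Proof.
have [->|p0] := eqVneq p 0; first by exists 0; near=> t; rewrite horner0 sgr0.
exists (sgp_right p x); near=> t; apply: (@sgr_neighpr _ (x + 1)); rewrite /neighpr in_itv /=.
apply/andP; split; near: t; first exact: nbhs_right_gt.
by apply: nbhs_right_lt; apply: next_root_gt; rewrite ?ltrDl.
Unshelve. all: by end_near. Qed.

Lemma sg_horner_at_left (p : {poly R}) (x : R) :
  exists c, \forall t \near x^'-, Num.sg p.[t] = c.
Proof.
have [->|p0] := eqVneq p 0; first by exists 0; near=> t; rewrite horner0 sgr0.
exists ((-1) ^+ (odd (polyorder.multiplicity x p)) * sgp_right p x); near=> t.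
apply: (@sgr_neighpl _ (x - 1)); rewrite /neighpl in_itv /=.
apply/andP; split; near: t; last exact: nbhs_left_lt.
by apply: nbhs_left_gt; apply: prev_root_lt; rewrite ?gtrBl.
Unshelve. all: by end_near. Qed.

Lemma qf_eval_germ (F : set_system R) (s : seq R) i (f : ordered_qelim.ord.formula R) :
    Filter F ->
    (forall p : {poly R}, exists c, \forall t \near F, Num.sg p.[t] = c) ->
    ordered_qelim.ord.qf_form f && ordered_qelim.ord.rformula f ->
  exists b, \forall t \near F, ordered_qelim.ord.qf_eval (set_nth 0 s i t) f = b.
Proof.
move=> FF Fp.
have term_sg (u v : GRing.term R) : GRing.rterm u && GRing.rterm v ->
    exists c, \forall t \near F,
      Num.sg (GRing.eval (set_nth 0 s i t) u - GRing.eval (set_nth 0 s i t) v) = c.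
  move=> /andP[ru rv].
  (* [abstrX i] reads a term as a polynomial in variable [i], the other variables taking their
     values in [s]; each atom thus becomes a sign condition on one univariate polynomial. *)
  pose tp w := qe_rcf.eval_poly s (qe_rcf.abstrX i (qe_rcf.to_rterm w)).
  have tpE w t : GRing.rterm w -> GRing.eval (set_nth 0 s i t) w = (tp w).[t].
    by move=> rw; rewrite qe_rcf.abstrXP qe_rcf.evalE qe_rcf.to_rtermE.
  have [c Fc] := Fp (tp u - tp v); exists c; near=> t.
  by rewrite !tpE// -hornerN -hornerD; near: t.
elim: f => //=.
- by move=> b _; exists b; near=> t.
- move=> u v /term_sg[c Fc]; exists (c == 0); near=> t.
  suff <- : Num.sg (GRing.eval (set_nth 0 s i t) u - GRing.eval (set_nth 0 s i t) v) = c.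
    by rewrite sgr_eq0 subr_eq0.
  by near: t.
- move=> u v /term_sg[c Fc]; exists (c < 0); near=> t.
  suff <- : Num.sg (GRing.eval (set_nth 0 s i t) u - GRing.eval (set_nth 0 s i t) v) = c.
    by rewrite sgr_lt0 subr_lt0.
  by near: t.
- move=> u v /term_sg[c Fc]; exists (c <= 0); near=> t.
  suff <- : Num.sg (GRing.eval (set_nth 0 s i t) u - GRing.eval (set_nth 0 s i t) v) = c.
    by rewrite sgr_le0 subr_le0.
  by near: t.
- move=> f1 + f2 + /andP[/andP[q1 q2] /andP[r1 r2]].
  rewrite q1 q2 r1 r2 => -[]// b1 F1 []// b2 F2; exists (b1 && b2); near=> t.
  by congr (_ && _); near: t.
- move=> f1 + f2 + /andP[/andP[q1 q2] /andP[r1 r2]].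
  rewrite q1 q2 r1 r2 => -[]// b1 F1 []// b2 F2; exists (b1 || b2); near=> t.
  by congr (_ || _); near: t.
- move=> f1 + f2 + /andP[/andP[q1 q2] /andP[r1 r2]].
  rewrite q1 q2 r1 r2 => -[]// b1 F1 []// b2 F2; exists (b1 ==> b2); near=> t.
  by congr (_ ==> _); near: t.
- move=> f1 + q1 => /(_ q1)[b F1]; exists (~~ b); near=> t.
  by congr (~~ _); near: t.
Unshelve. all: by end_near. Qed.

(** After elimination of quantifiers [A] is a boolean combination of sign conditions on univariate
    polynomials, and each of these is eventually constant along [F]. *)
Lemma definable_germ (F : set_system R) (A : R -> Prop) : Filter F ->
    (forall p : {poly R}, exists c, \forall t \near F, Num.sg p.[t] = c) ->
    definable (fun e => A (e 0%N)) ->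
  (\forall t \near F, A t) \/ (\forall t \near F, ~ A t).
Proof.
move=> FF Fp [f rf fA].
pose wproj n sc : ordered_qelim.ord.formula R :=
  qe_rcf.qfr_to_formula (@qe_rcf.wproj R n sc).
have wf_wproj : forall i bc, ordered_qelim.ord.dnf_rterm _ -> _ := @qe_rcf.wf_QE_wproj R.
have valid_wproj := @qe_rcf.valid_QE_wproj R.
have wf := ordered_qelim.ord.quantifier_elim_wf wf_wproj rf.
have [b Fb] := qf_eval_germ [::] 0 FF Fp wf.
have AE t : A t <-> ordered_qelim.ord.qf_eval (set_nth 0 [::] 0 t)
    (ordered_qelim.ord.quantifier_elim wproj f).
  have := fA (set_nth 0 [::] 0%N t); rewrite nth_set_nth /= => <-.
  by split=> /(ordered_qelim.ord.quantifier_elim_rformP wf_wproj valid_wproj _ rf).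
case: b Fb => Fb; [left|right]; near=> t; rewrite AE.
  by near: t.
by apply/negP; rewrite -eqbF_neg; apply/eqP; near: t.
Unshelve. all: by end_near. Qed.

Lemma definable_at_right (A : R -> Prop) (x : R) : definable (fun e => A (e 0%N)) ->
  (\forall t \near x^'+, A t) \/ (\forall t \near x^'+, ~ A t).
Proof. by apply: definable_germ => p; exact: sg_horner_at_right. Qed.

Lemma definable_at_left (A : R -> Prop) (x : R) : definable (fun e => A (e 0%N)) ->
  (\forall t \near x^'-, A t) \/ (\forall t \near x^'-, ~ A t).
Proof. by apply: definable_germ => p; exact: sg_horner_at_left. Qed.

End Germs.

(** * Monotonicity of definable functions of one variable *)

Section Monotonicity.

Variable R : realType.
Implicit Types (h : R -> R).

(** Rewrites a filter statement with quantifiers over reals only, so that it can be turned into a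
    formula. *)
Lemma near_at_rightE (x : R) (P : R -> Prop) :
  (\forall s \near x^'+, P s) <-> exists2 d, 0 < d & forall s, x < s -> s < x + d -> P s.
Proof.
split=> [/nbhs_right0P[d /= d0 dP]|[d d0 dP]].
  exists d => // s xs sd; have := dP (s - x); rewrite /= subrKC; apply.
    by rewrite sub0r normrN gtr0_norm ?subr_gt0// ltrBlDl.
  by rewrite subr_gt0.
near=> s; apply: dP; first by near: s; exact: nbhs_right_gt.
by near: s; apply: nbhs_right_lt; rewrite ltrDl.
Unshelve. all: by end_near. Qed.

Lemma near_at_leftE (x : R) (P : R -> Prop) :
  (\forall s \near x^'-, P s) <-> exists2 d, 0 < d & forall s, x - d < s -> s < x -> P s.
Proof.
split=> [/nbhs_left0P[d /= d0 dP]|[d d0 dP]].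
  exists d => // s sd xs; have := dP (x - s); rewrite /= subKr; apply.
    by rewrite sub0r normrN gtr0_norm ?subr_gt0// ltrBlDr -ltrBlDl.
  by rewrite subr_gt0.
near=> s; apply: dP; last by near: s; exact: nbhs_left_lt.
by near: s; apply: nbhs_left_gt; rewrite gtrBl.
Unshelve. all: by end_near. Qed.

Lemma updE (e : nat -> R) i x : upd e i x i = x.
Proof. by rewrite /upd eqxx. Qed.

Lemma upd_neq (e : nat -> R) i j x : (j != i)%N -> upd e i x j = e j.
Proof. by rewrite /upd => /negbTE ->. Qed.

Lemma definable_near_right (Q : R -> R -> Prop) :
  definable (fun e => Q (e 0%N) (e 1%N)) ->
  definable (fun e => \forall s \near (e 0%N)^'+, Q (e 0%N) s).
Proof.
move=> dQ.
have v i := @polynomial_term_var R i; have c x := @polynomial_term_const R x.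
have := definable_ex 2 (definable_and (definable_lt (c 0) (v 2)) (definable_all 1
  (definable_imp (definable_lt (v 0) (v 1)) (definable_imp
    (definable_lt (v 1) (polynomial_termD (v 0) (v 2))) dQ)))).
apply: eq_definable => e; rewrite near_at_rightE.
by split=> [[d []]|[d]] d0 Qd; exists d.
Qed.

Lemma definable_near_left (Q : R -> R -> Prop) :
  definable (fun e => Q (e 0%N) (e 1%N)) ->
  definable (fun e => \forall s \near (e 0%N)^'-, Q (e 0%N) s).
Proof.
move=> dQ.
have v i := @polynomial_term_var R i; have c x := @polynomial_term_const R x.
have := definable_ex 2 (definable_and (definable_lt (c 0) (v 2)) (definable_all 1
  (definable_imp (definable_lt (polynomial_termB (v 0) (v 2)) (v 1)) (definable_imp
    (definable_lt (v 1) (v 0)) dQ)))).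
apply: eq_definable => e; rewrite near_at_leftE.
by split=> [[d []]|[d]] d0 Qd; exists d.
Qed.

(** Induction along the interval, without continuity: the left condition carries the comparison with
    [h s] up to the supremum [c] of the points reached, and the right condition carries it beyond
    [c] unless [c] is already [t]. *)
Lemma nondecreasing_local h (a b : R) :
    (forall t, a < t -> t < b ->
      (\forall s \near t^'+, h t <= h s) /\ (\forall s \near t^'-, h s <= h t)) ->
  forall s t, a < s -> s <= t -> t < b -> h s <= h t.
Proof.
move=> loc s t a_s st tb.
pose S := [set u | s <= u <= t /\ forall v, s <= v -> v <= u -> h s <= h v].
have Ss : S s.
  by split=> [|v sv vs]; [rewrite lexx|rewrite (@le_anti _ _ s v) ?sv].
have ubS : ubound S t by move=> u [/andP[]].
have supS : has_sup S by split; [exists s|exists t].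
set c := sup S.
have sc : s <= c by apply: ub_le_sup Ss; exists t.
have ct : c <= t by apply: ge_sup => //; exists s.
have [locr locl] := loc c (lt_le_trans a_s sc) (le_lt_trans ct tb).
have hv v : s <= v -> v < c -> h s <= h v.
  move=> sv vc; have [u [_ Su] vu] := sup_gt supS.1 vc.
  by apply: Su => //; exact: ltW.
have hc : h s <= h c.
  have [<-//|sNc] := eqVneq s c.
  have sc' : s < c by rewrite lt_neqAle sNc.
  near (c^'-) => v; apply: (@le_trans _ _ (h v)); last by near: v.
  apply: hv; last by near: v; exact: nbhs_left_lt.
  by near: v; exact: nbhs_left_ge.
have [<-//|cNt] := eqVneq c t.
have ct' : c < t by rewrite lt_neqAle cNt.
move: locr => /near_at_rightE[d d0 dP].
pose u := Num.min t (c + d / 2).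
have cu : c < u by rewrite lt_min ct' ltrDl divr_gt0.
have : S u.
  split; first by rewrite ge_min lexx/= (le_trans sc (ltW cu)).
  move=> v sv vu; have [/hv->//|cv] := ltP v c.
  have [<-//|vNc] := eqVneq c v; apply: le_trans hc (dP _ _ _).
    by rewrite lt_neqAle vNc.
  apply: le_lt_trans vu _; rewrite gt_min; apply/orP; right.
  by rewrite ltrD2l gtr_pMr// invf_lt1// ltr1n.
by move=> /(ub_le_sup supS.2); rewrite leNgt cu.
Unshelve. all: by end_near. Qed.

End Monotonicity.

(** The graph is asked for in every pair of variables, so that it can be inserted into larger
    formulas without a renaming lemma. *)
Definition definable_fun (R : realType) (h : R -> R) : Prop :=
  forall i j, definable (fun e => e j = h (e i)).

Section MonotonicityTheorem.

Variable R : realType.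
Implicit Types (h : R -> R).

Lemma definable_fun_le h : definable_fun h ->
  definable (fun e => h (e 0%N) <= h (e 1%N)).
Proof.
move=> dh; have v i := @polynomial_term_var R i.
have := definable_ex 2 (definable_ex 3 (definable_and (dh 0%N 2%N)
  (definable_and (dh 1%N 3%N) (definable_le (v 2) (v 3))))).
apply: eq_definable => e; rewrite /upd /=; split=> [[x [y [-> [->]]]]//|le_h].
by exists (h (e 0%N)), (h (e 1%N)).
Qed.

Lemma definable_fun_gt h c : definable_fun h -> definable (fun e => c < h (e 0%N)).
Proof.
move=> dh; have := definable_ex 1 (definable_and (dh 0%N 1%N)
  (definable_lt (@polynomial_term_const R c) (@polynomial_term_var R 1))).
apply: eq_definable => e; rewrite /upd /=; split=> [[x [->]]//|lt_h].
by exists (h (e 0%N)).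
Qed.

Lemma definable_funN h : definable_fun h -> definable_fun (fun t => - h t).
Proof.
move=> dh i j; have := definable_ex (i + j).+1 (definable_and (dh i (i + j).+1)
  (definable_eq (@polynomial_term_var R j) (polynomial_termN (@polynomial_term_var R (i + j).+1)))).
apply: eq_definable => e; rewrite /upd /= eqxx.
have /negbTE-> : i != (i + j).+1 by rewrite ltn_eqF// ltnS leq_addr.
have /negbTE-> : j != (i + j).+1 by rewrite ltn_eqF// ltnS leq_addl.
by split=> [[x [->]]//|->]; exists (h (e i)).
Qed.

Lemma definable_fun_image h eps : definable_fun h ->
  definable (fun e => [set h t | t in [set t | 0 < t < eps]] (e 0%N)).
Proof.
move=> dh; have v i := @polynomial_term_var R i; have c x := @polynomial_term_const R x.
have := definable_ex 1 (definable_and (definable_and (definable_lt (c 0) (v 1))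
  (definable_lt (v 1) (c eps))) (dh 1%N 0%N)).
apply: eq_definable => e; rewrite /upd /=; split=> [[t [[t0 te] ->]]|[t /andP[t0 te] ht]].
  by exists t => //; apply/andP.
by exists t.
Qed.

(** The limit is the lower limit, written as a supremum. A level above it is not eventually
    exceeded, and the germ dichotomy strengthens this to: eventually not exceeded. *)
Lemma definable_fun_lim h M : definable_fun h -> (forall t, `|h t| <= M) ->
  exists L, forall eta, 0 < eta -> \forall t \near 0^'+, `|h t - L| < eta.
Proof.
move=> dh hM; pose S := [set c | \forall t \near 0^'+, c < h t].
have S0 : S (- M - 1).
  near=> t; have := hM t; rewrite ler_norml => /andP[+ _]; apply: lt_le_trans.
  by rewrite gtrBl.
have ubS : ubound S M.
  move=> c Sc; near (0 : R)^'+ => t; apply/ltW; apply: (@lt_le_trans _ _ (h t)).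
    by near: t.
  by have := hM t; rewrite ler_norml => /andP[].
have supS : has_sup S by split; [exists (- M - 1)|exists M].
exists (sup S) => eta eta0.
have [c Sc cL] := sup_adherent eta0 supS.
have : ~ S (sup S + eta / 2).
  by move=> /(ub_le_sup supS.2); rewrite gerDl leNgt divr_gt0.
case: (@definable_at_right _ (fun t => sup S + eta / 2 < h t) 0
    (definable_fun_gt _ dh)) => // leL _.
near=> t; rewrite ltr_norml; apply/andP; split.
  rewrite ltrBrDl; apply: lt_trans cL _; near: t; exact: Sc.
have /negP : ~ (sup S + eta / 2 < h t) by near: t.
rewrite -leNgt ltrBlDl => /le_lt_trans; apply; rewrite ltrD2l.
by rewrite gtr_pMr// invf_lt1// ltr1n.
Unshelve. all: by end_near. Qed.

(** A local minimum value is the least value of [h] on some interval with rational endpoints, hence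
    is determined by that pair of rationals. *)
Lemma local_min_countable h eps :
    (forall t, 0 < t -> t < eps ->
      (\forall s \near t^'+, h t <= h s) /\ (\forall s \near t^'-, h t <= h s)) ->
  countable [set h t | t in [set t | 0 < t < eps]].
Proof.
move=> loc.
pose minval (pq : rat * rat) (y : R) :=
  (exists2 t, ratr pq.1 < t < ratr pq.2 & h t = y) /\
  (forall s, ratr pq.1 < s -> s < ratr pq.2 -> y <= h s).
pose G pq := xget 0 (minval pq).
apply: (@sub_countable _ _ _ (range G)); last first.
  exact: sub_countable (card_image_le G setT) (countableP _).
apply: subset_card_le => _ [t /andP[t0 te] <-].
have [/near_at_rightE[d d0 dP] /near_at_leftE[d' d'0 d'P]] := loc t t0 te.
have [q] : exists q : rat, ratr q \in `]t, (t + d)[ by apply: rat_in_itvoo; rewrite ltrDl.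
have [p] : exists p : rat, ratr p \in `](t - d'), t[ by apply: rat_in_itvoo; rewrite gtrBl.
rewrite !in_itv /= => /andP[pt tp] /andP[tq qt].
exists (p, q) => //; rewrite /G; apply: xget_unique.
  split; first by exists t; rewrite //= tp.
  move=> s /= ps sq; have [ts|st|->//] := ltgtP t s.
    by apply: dP => //; exact: lt_trans sq qt.
  by apply: d'P => //; exact: lt_trans pt ps.
move=> _ [[s /andP[/= ps sq] <-] smin]; apply/le_anti.
rewrite smin//= .
have [ts|st|->//] := ltgtP t s.
  by apply: dP => //; exact: lt_trans sq qt.
by apply: d'P => //; exact: lt_trans pt ps.
Qed.

Lemma countable_itv_absurd (A : set R) a b : countable A -> a < b ->
  ~ (forall y, a < y -> y < b -> A y).
Proof.
move=> cA ab sA.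
have : countable [set` `]a, b[].
  apply: sub_countable cA; apply: subset_card_le => y /=.
  by rewrite in_itv /= => /andP[]; exact: sA.
move=> /countable_lebesgue_measure0; rewrite lebesgue_measure_itv /= lte_fin ab.
by move=> /eqP; rewrite -EFinD eqe subr_eq0 gt_eqF.
Qed.

(* The set of values is countable and definable, hence has no point near the
   limit of [h] at [0], except possibly that limit. *)
Lemma definable_local_min h M eps : definable_fun h -> (forall t, `|h t| <= M) ->
    0 < eps ->
    (forall t, 0 < t -> t < eps ->
      (\forall s \near t^'+, h t <= h s) /\ (\forall s \near t^'-, h t <= h s)) ->
  exists L, \forall t \near 0^'+, h t = L.
Proof.
move=> dh hM eps0 /local_min_countable cA.
have [L hL] := definable_fun_lim dh hM; exists L.
set A := [set h t | t in _] in cA.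
have dA : definable (fun e => A (e 0%N)) := definable_fun_image eps dh.
have : \forall y \near L^'+, ~ A y.
  case: (definable_at_right L dA) => // /near_at_rightE[d d0 dP].
  by exfalso; apply: (countable_itv_absurd cA _ dP); rewrite ltrDl.
move=> /near_at_rightE[d d0 dP].
have : \forall y \near L^'-, ~ A y.
  case: (definable_at_left L dA) => // /near_at_leftE[d' d'0 d'P].
  by exfalso; apply: (countable_itv_absurd cA _ d'P); rewrite gtrBl.
move=> /near_at_leftE[d' d'0 d'P].
near=> t.
have At : A (h t).
  exists t => //; apply/andP; split; near: t; first exact: nbhs_right_gt.
  exact: nbhs_right_lt.
have : `|h t - L| < Num.min d d' by near: t; apply: hL; rewrite lt_min d0.
rewrite lt_min !ltr_norml => /andP[/andP[_ hd] /andP[hd' _]].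
have [lt|lt|//] := ltgtP (h t) L.
  by exfalso; apply: (d'P (h t)) => //; lra.
by exfalso; apply: (dP (h t)) => //; rewrite -ltrBlDl.
Unshelve. all: by end_near. Qed.

Lemma definable_monotone h M : definable_fun h -> (forall t, `|h t| <= M) ->
  exists2 eps, 0 < eps &
    (forall s t, 0 < s -> s <= t -> t < eps -> h s <= h t) \/
    (forall s t, 0 < s -> s <= t -> t < eps -> h t <= h s).
Proof.
move=> dh hM.
have dle := definable_fun_le dh.
have dNh := definable_funN dh.
have NhM t : `|- h t| <= M by rewrite normrN.
have dR := @definable_near_right _ (fun t s => h t <= h s) dle.
have dL := @definable_near_left _ (fun t s => h t <= h s) dle.
have dgt x : definable (fun e => h x <= h (e 0%N)).
  apply: eq_definable (definable_not (definable_fun_gt (- h x) dNh)) => e.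
  by rewrite ltrN2 leNgt; split=> /negP.
(* The dichotomy at [x] turns the failure of one eventual inequality into the eventual opposite
   inequality. *)
have negR x : ~ (\forall s \near x^'+, h x <= h s) -> \forall s \near x^'+, h s <= h x.
  case: (@definable_at_right _ (fun s => h x <= h s) x (dgt x)) => // lt _; near=> s.
  by apply/ltW; rewrite ltNge; apply/negP; near: s.
have negL x : ~ (\forall s \near x^'-, h x <= h s) -> \forall s \near x^'-, h s <= h x.
  case: (@definable_at_left _ (fun s => h x <= h s) x (dgt x)) => // lt _; near=> s.
  by apply/ltW; rewrite ltNge; apply/negP; near: s.
have const : (exists L, \forall t \near 0^'+, h t = L) -> exists2 eps, 0 < eps &
    (forall s t, 0 < s -> s <= t -> t < eps -> h s <= h t) \/
    (forall s t, 0 < s -> s <= t -> t < eps -> h t <= h s).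
  move=> [L /near_at_rightE[d d0 dP]]; exists d => //; left => s t s0 st td.
  by rewrite !dP ?add0r// ?(lt_le_trans s0)// (le_lt_trans st).
(* For all small [t], the comparison of [h t] with nearby values on each side is of one fixed type.
   Both neighbours above, or both below, give a function constant near 0; the two mixed types are
   local monotonicity. *)
have [|] := @definable_at_right _ (fun t => \forall s \near t^'+, h t <= h s) 0 dR;
  have [|] := @definable_at_right _ (fun t => \forall s \near t^'-, h t <= h s) 0 dL;
  move=> /near_at_rightE[d d0 dP] /near_at_rightE[d' d'0 d'P];
  have mind : 0 < Num.min d d' by rewrite lt_min d0.
- apply: const; apply: (definable_local_min dh hM mind) => t t0.
  by rewrite lt_min => /andP[td td']; split; [apply: d'P|apply: dP]; rewrite ?add0r.
- exists (Num.min d d') => //; left; apply: nondecreasing_local => t t0.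
  rewrite lt_min => /andP[td td']; split; first by apply: d'P; rewrite ?add0r.
  by apply: negL; apply: dP; rewrite ?add0r.
- exists (Num.min d d') => //; right => s t s0 st t_lt; rewrite -lerN2.
  apply: (@nondecreasing_local _ (fun t => - h t)) s0 st t_lt => {}t t0.
  rewrite lt_min => /andP[td td']; split.
    by under eq_near do rewrite lerN2; apply: negR; apply: d'P; rewrite ?add0r.
  by under eq_near do rewrite lerN2; apply: dP; rewrite ?add0r.
- apply: const; have [L hL] : exists L, \forall t \near 0^'+, - h t = L.
    apply: (definable_local_min dNh NhM mind) => t t0.
    rewrite lt_min => /andP[td td']; split.
      by under eq_near do rewrite lerN2; apply: negR; apply: d'P; rewrite ?add0r.
    by under eq_near do rewrite lerN2; apply: negL; apply: dP; rewrite ?add0r.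
  by exists (- L); near=> t; rewrite -[h t]opprK; congr (- _); near: t.
Unshelve. all: by end_near. Qed.

End MonotonicityTheorem.

(** * Definable choice in compact families *)

Lemma closed_le_fun (R : realType) (T : topologicalType) (f g : T -> R) :
  continuous f -> continuous g -> closed [set x | f x <= g x].
Proof.
move=> cf cg.
have -> : [set x | f x <= g x] = (fun x => f x - g x) @^-1` [set y | y <= 0].
  by apply/seteqP; split => x /=; rewrite subr_le0.
apply: preimage_closed; last exact: closed_le.
by move=> x _; apply: cvgB; [exact: cf|exact: cg].
Qed.

Definition coord_argmin (R : realType) (m : nat) (i : 'I_m) (A : set 'rV[R]_m) :
    set 'rV[R]_m :=
  [set v | A v /\ forall w, A w -> v ord0 i <= w ord0 i].

(** Minimizing the coordinates one after another singles out a point by a formula, which makes the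
    choice definable; compactness keeps every stage nonempty. *)
Definition lex_argmin (R : realType) (m : nat) (r : seq 'I_m) (A : set 'rV[R]_m) :
    set 'rV[R]_m :=
  foldl (fun B i => coord_argmin i B) A r.

Definition definable_family (R : realType) (m : nat) (W : R -> set 'rV[R]_m) : Prop :=
  forall i k, definable (fun e => W (e i) (vec m e k)).

Section Selection.

Variables (R : realType) (m : nat).
Implicit Types (A : set 'rV[R]_m) (W : R -> set 'rV[R]_m).

Lemma definable_coord_argmin W j :
  definable_family W -> definable_family (fun t => coord_argmin j (W t)).
Proof.
move=> dW i k; pose K := maxn i.+1 (k + m).
have := definable_and (dW i k) (definable_allv K m (definable_imp (dW i K)
  (definable_le (@polynomial_term_var R (k + j)) (@polynomial_term_var R (K + j))))).
apply: eq_definable => e; rewrite /coord_argmin /=.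
have E (w : 'rV[R]_m) : [/\ updv e K w i = e i, vec m (updv e K w) K = w,
    updv e K w (k + j)%N = vec m e k ord0 j & updv e K w (K + j)%N = w ord0 j].
  split; first by rewrite updv_lt// leq_maxl.
  - by rewrite vec_updv.
  - by rewrite mxE updv_lt// leq_max -addnS leq_add2l ltn_ord orbT.
  - by rewrite -[in RHS](vec_updv e K w) mxE.
split=> -[We minv]; split=> // w; have := minv w; case: (E w) => -> -> -> ->//.
Qed.

Lemma definable_lex_argmin W r :
  definable_family W -> definable_family (fun t => lex_argmin r (W t)).
Proof.
elim: r W => // i r IH W dW; apply: (IH (fun t => coord_argmin i (W t))).
exact: definable_coord_argmin.
Qed.

Lemma compact_coord_argmin i A : A !=set0 -> compact A ->
  coord_argmin i A !=set0 /\ compact (coord_argmin i A).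
Proof.
move=> A0 cA.
have cont : continuous (fun v : 'rV[R]_m => v ord0 i) := @coord_continuous R 1 m ord0 i.
have [c + cmin] := compact_EVT_min A0 cA (continuous_subspaceT cont).
rewrite inE => Ac; have {}cmin w : A w -> c ord0 i <= w ord0 i.
  by move=> Aw; apply: cmin; rewrite inE.
split; first by exists c.
have -> : coord_argmin i A = A `&` [set v | v ord0 i <= c ord0 i].
  apply/seteqP; split=> v [Av /= vmin]; split=> //; first exact: vmin.
  by move=> w /cmin; exact: le_trans.
have clA : closed A by apply: compact_closed => //; exact: norm_hausdorff.
have clc : closed [set v : 'rV[R]_m | v ord0 i <= c ord0 i].
  by apply: closed_le_fun => //; exact: cst_continuous.
exact: subclosed_compact (closedI clA clc) cA (@subIsetl _ _ _).
Qed.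

Lemma lex_argmin_neq0 r A : A !=set0 -> compact A -> lex_argmin r A !=set0.
Proof.
elim: r A => // i r IH A A0 cA.
by have [B0 cB] := compact_coord_argmin i A0 cA; exact: IH.
Qed.

Lemma lex_argmin_sub r A : lex_argmin r A `<=` A.
Proof.
elim: r A => [|i r IH] A; first exact: subset_refl.
by move=> v Lv; have [] := IH (coord_argmin i A) v Lv.
Qed.

Lemma lex_argmin_head i r A v w : lex_argmin (i :: r) A v -> A w -> v ord0 i <= w ord0 i.
Proof. by move=> Lv; have [_] := @lex_argmin_sub r (coord_argmin i A) v Lv; exact. Qed.

Lemma lex_argmin_uniq i r A v w : i \in r ->
  lex_argmin r A v -> lex_argmin r A w -> v ord0 i = w ord0 i.
Proof.
elim: r A => // j r IH A; rewrite in_cons => /predU1P[->|ir]; last exact: IH.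
move=> Lv Lw; apply/le_anti.
by rewrite (lex_argmin_head Lv) ?(lex_argmin_head Lw)//; apply: lex_argmin_sub; eassumption.
Qed.

(** The formula must also describe the default value 0 of [xget], taken at the parameters where [W]
    is empty. *)
Lemma definable_xget W (i : 'I_m) : definable_family W ->
    (forall t v w, W t v -> W t w -> v ord0 i = w ord0 i) ->
  definable_fun (fun t => (xget 0 (W t)) ord0 i).
Proof.
move=> dW Wuniq a b; pose K := maxn a.+1 b.+1.
have d1 := definable_exv K m (definable_and (dW a K)
  (definable_eq (@polynomial_term_var R b) (@polynomial_term_var R (K + i)))).
have d2 := definable_not (definable_exv K m (dW a K)).
have := definable_or d1 (definable_and d2
  (definable_eq (@polynomial_term_var R b) (@polynomial_term_const R 0))).
apply: eq_definable => e.
have E (w : 'rV[R]_m) : [/\ updv e K w a = e a, vec m (updv e K w) K = w,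
    updv e K w b = e b & updv e K w (K + i)%N = w ord0 i].
  split; first by rewrite updv_lt// leq_maxl.
  - by rewrite vec_updv.
  - by rewrite updv_lt// leq_maxr.
  - by rewrite -[in RHS](vec_updv e K w) mxE.
have [[v Wv]|nW] := pselect (W (e a) !=set0).
  have Wx := xgetI 0 Wv; split=> [[[w]|[+ _]]|eb].
  - by have [-> -> -> ->] := E w => -[Ww ->]; exact: Wuniq Ww Wx.
  - by case; exists v; have [-> -> _ _] := E v.
  - by left; exists (xget 0 (W (e a))); have [-> -> -> ->] := E (xget 0 (W (e a))); split.
rewrite xgetPN ?mxE; last by move=> w Ww; apply: nW; exists w.
split=> [[[w]|[_]//]|eb].
  by have [-> -> -> ->] := E w => -[Ww]; case: nW; exists w.
by right; split=> // -[w]; have [-> -> _ _] := E w => Ww; apply: nW; exists w.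
Qed.

(** Putting [i0] first makes the chosen point minimal in that coordinate; listing all the
    coordinates after it makes the point unique. *)
Lemma monotone_selection W (M : R) (i0 : 'I_m) :
    definable_family W -> (forall t, compact (W t)) -> 0 <= M ->
    (forall t v i, W t v -> `|v ord0 i| <= M) ->
    (forall eps, 0 < eps -> exists t, 0 < t < eps /\ W t !=set0) ->
  exists (y : R -> 'rV[R]_m) (eps : R), 0 < eps /\
    (forall t, 0 < t -> t < eps ->
      W t (y t) /\ forall w, W t w -> y t ord0 i0 <= w ord0 i0) /\
    forall i,
      (forall s t, 0 < s -> s <= t -> t < eps -> y s ord0 i <= y t ord0 i) \/
      (forall s t, 0 < s -> s <= t -> t < eps -> y t ord0 i <= y s ord0 i).
Proof.
move=> dW cW M0 WM W0; pose L t := lex_argmin (i0 :: enum 'I_m) (W t).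
have dL : definable_family L by exact: definable_lex_argmin.
pose y t := xget 0 (L t).
have Luniq i t v w : L t v -> L t w -> v ord0 i = w ord0 i.
  by apply: lex_argmin_uniq; rewrite in_cons mem_enum orbT.
have yM i t : `|y t ord0 i| <= M.
  rewrite /y; case: xgetP => [v _ /lex_argmin_sub/WM//|_].
  by rewrite mxE normr0.
have /all_sig2[mon mon0 monP] : forall i, {eps | 0 < eps &
    (forall s t, 0 < s -> s <= t -> t < eps -> y s ord0 i <= y t ord0 i) \/
    (forall s t, 0 < s -> s <= t -> t < eps -> y t ord0 i <= y s ord0 i)}.
  move=> i; apply: cid2; apply: (definable_monotone _ (yM i)).
  by apply: (definable_xget dL) => t v w; exact: Luniq.
have dW0 : definable (fun e => W (e 0%N) !=set0).
  apply: eq_definable (definable_exv 1 m (dW 0%N 1%N)) => e.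
  by split=> -[w Ww]; exists w; move: Ww; rewrite vec_updv updv_lt.
(* Nonemptiness at arbitrarily small parameters excludes the alternative that [W t] is eventually
   empty. *)
have : \forall t \near 0^'+, W t !=set0.
  case: (@definable_at_right _ (fun t => W t !=set0) 0 dW0) => //.
  move=> /near_at_rightE[d d0 dP]; have [t [/andP[t0 td] Wt]] := W0 d d0.
  by case: (dP t); rewrite ?add0r.
move=> /near_at_rightE[d d0 dP].
exists y, (\big[Num.min/d]_(i < m) mon i); split.
  by apply: (big_ind (fun x => 0 < x)) => // a b a0 b0; rewrite lt_min a0.
split=> [t t0 td|i].
  have [v Lv] : L t !=set0.
    apply: lex_argmin_neq0 => //; apply: dP => //; rewrite add0r.
    apply: lt_le_trans td _; exact: bigmin_le_id.
  have Ly : L t (y t) := xgetI 0 Lv; split; first exact: lex_argmin_sub Ly.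
  by move=> w; exact: lex_argmin_head Ly.
have le_mon : \big[Num.min/d]_(i < m) mon i <= mon i by exact: bigmin_le.
by case: (monP i) => mono; [left|right] => s t s0 st td; apply: mono => //;
  exact: lt_le_trans td le_mon.
Qed.

End Selection.

(** * Desingularization *)

Section Desingularization.

Variable R : realType.
Implicit Types (V sigma : R -> R).

(* On a subdivision into [n ^ 2] equal steps, the quadratic term is harmless on
   a step where the increment of [V] is at most [1 / n], and there are few
   other steps. *)
Lemma le_variation V (alpha beta K C : R) : alpha <= beta -> 0 <= K -> 0 <= C ->
    (forall s t, alpha <= s -> s <= t -> t <= beta ->
      0 <= V t - V s /\ t - s <= K * (V t - V s) + C * (V t - V s) ^+ 2) ->
  beta - alpha <= K * (V beta - V alpha).
Proof.
move=> ab K0 C0 HV; pose L := beta - alpha; pose T := V beta - V alpha.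
have L0 : 0 <= L by rewrite subr_ge0.
have T0 : 0 <= T by case: (HV alpha beta).
(* It suffices to bound one step of length [D] and increment [d] by [(K + (C + L) / n) * d], since
   the increments telescope. If [d] is at most [1 / n], then [C / n] pays for the quadratic term;
   otherwise [n * d >= 1], and [L / n = n * D] pays for the whole step. *)
have step n : (0 < n)%N -> L <= (K + (C + L) / n%:R) * T.
  move=> n0; have n0R : 0 < n%:R :> R by rewrite ltr0n.
  pose D := L / (n%:R ^+ 2); pose p k := alpha + D * k%:R.
  have D0 : 0 <= D by rewrite divr_ge0// exprn_ge0// ltW.
  have pn : p (n ^ 2)%N = beta.
    by rewrite /p /D natrX divfK ?expf_neq0 ?gt_eqF// /L; lra.
  have p_le i j : (i <= j)%N -> p i <= p j.
    by move=> ij; rewrite lerD2l ler_wpM2l// ler_nat.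
  have p0 : p 0%N = alpha by rewrite /p mulr0 addr0.
  suff /(_ (n ^ 2)%N (leqnn _)) : forall k, (k <= n ^ 2)%N ->
      p k - alpha <= (K + (C + L) / n%:R) * (V (p k) - V alpha) by rewrite pn.
  elim=> [_|k IH kn]; first by rewrite p0 !subrr mulr0.
  have {}IH := IH (ltnW kn).
  have [||d0 dle] := HV (p k) (p k.+1) _ (p_le _ _ (leqnSn k)).
  - by rewrite -p0; exact: p_le.
  - by rewrite -pn; exact: p_le.
  set d := V (p k.+1) - V (p k) in d0 dle.
  have pS : p k.+1 - p k = D by rewrite /p -natr1; lra.
  rewrite pS in dle.
  suff : D <= (K + (C + L) / n%:R) * d.
    have -> : V (p k.+1) - V alpha = (V (p k) - V alpha) + d by rewrite /d; lra.
    have -> : p k.+1 - alpha = (p k - alpha) + D by rewrite -pS; lra.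
    by move=> h; rewrite mulrDr; apply: lerD.
  have nDE : n%:R * D = L / n%:R by rewrite /D; field; rewrite gt_eqF.
  have LD0 : 0 <= L / n%:R by rewrite divr_ge0// ltW.
  have Cn0 : 0 <= C / n%:R by rewrite divr_ge0// ltW.
  rewrite mulrDl; have [dn|dn] := leP d n%:R^-1.
    apply: le_trans dle _; rewrite lerD2l expr2 mulrA.
    apply: ler_wpM2r => //; rewrite mulrDl; apply: le_trans (_ : C / n%:R <= _).
      exact: ler_wpM2l.
    by rewrite lerDl.
  have nd : 1 <= n%:R * d by rewrite -ler_pdivrMl// mulr1 ltW.
  have : D <= L / n%:R * d by rewrite -nDE mulrAC mulrC ler_peMr.
  move=> /le_trans; apply; rewrite (mulrDl C) mulrDl addrA lerDr.
  by rewrite addr_ge0// mulr_ge0.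
(* Letting [n] grow removes the error term; the archimedean property supplies an [n] contradicting a
   strict excess. *)
rewrite leNgt; apply/negP => lt_KT.
have e0 : 0 < L - K * T by rewrite subr_gt0.
have CLT : 0 <= (C + L) * T by rewrite mulr_ge0// addr_ge0.
pose n := (Num.truncn ((C + L) * T / (L - K * T))).+1.
have : (C + L) * T / (L - K * T) < n%:R by exact: truncnS_gt.
rewrite ltr_pdivrMr// => n_gt; have := step n isT.
rewrite mulrDl mulrAC -lerBlDl ler_pdivlMr ?ltr0n// mulrC leNgt.
by rewrite n_gt.
Qed.

(** If [sigma] is nondecreasing, it is at most [sigma t] on the interval from [s] to [t], and
    [le_variation] shows that [V] itself works. If [sigma] is nonincreasing, it is bounded below by
    a positive constant near 0, and a linear [U] works. *)
Lemma desingularization V sigma (C B eps : R) : 0 < eps -> 0 <= C ->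
    (forall t, 0 < t -> t < eps -> 0 <= sigma t) ->
    (forall t, 0 < t -> t < eps -> `|V t| <= B) ->
    (forall s t, 0 < s -> s <= t -> t < eps -> V s <= V t) ->
    (forall s t, 0 < s -> s <= t -> t < eps ->
      t - s <= sigma t * (V t - V s) + C * (V t - V s) ^+ 2) ->
    (forall s t, 0 < s -> s <= t -> t < eps -> sigma s <= sigma t) \/
    (forall s t, 0 < s -> s <= t -> t < eps -> sigma t <= sigma s) ->
  exists U eps' B', [/\ 0 < eps',
    forall s t, 0 < s -> s <= t -> t < eps' -> U s <= U t,
    forall t, 0 < t -> t < eps' -> `|U t| <= B' &
    forall s t, 0 < s -> s <= t -> t < eps' -> t - s <= sigma t * (U t - U s)].
Proof.
move=> eps0 C0 sigma0 VB Vmono HV.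
have bound K alpha beta : 0 < alpha -> alpha <= beta -> beta < eps ->
    (forall t, alpha <= t -> t <= beta -> sigma t <= K) ->
    beta - alpha <= K * (V beta - V alpha).
  move=> a0 ab be sK; apply: (le_variation ab _ C0).
    by apply: le_trans (sK alpha _ _) => //; apply: sigma0 => //; exact: le_lt_trans be.
  move=> s t als st tb; have s0 := lt_le_trans a0 als; have te := le_lt_trans tb be.
  have V0 : 0 <= V t - V s by rewrite subr_ge0 Vmono.
  split=> //; apply: le_trans (HV s t s0 st te) _; rewrite lerD2r ler_wpM2r//.
  by apply: sK => //; exact: le_trans st.
move=> [mono|anti].
  exists V, eps, B; split=> // s t s0 st te; apply: bound => // u su ut.
  by apply: mono => //; exact: lt_le_trans su.
have e4 : 0 < eps / 4 by rewrite divr_gt0.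
have b0 : 0 < eps / 2 by rewrite divr_gt0.
(* Otherwise [sigma] would vanish from [eps / 2] on, and [le_variation] with [K = 0] would bound the
   positive length [eps / 4] by 0. *)
have s0 : 0 < sigma (eps / 2).
  rewrite lt_def sigma0//; last by lra.
  rewrite andbT; apply/eqP => sE.
  suff : eps / 2 + eps / 4 - eps / 2 <= 0 * (V (eps / 2 + eps / 4) - V (eps / 2)).
    by rewrite mul0r; lra.
  apply: bound => //; [lra|lra|move=> t bt tb].
  by rewrite -sE; apply: anti => //; apply: le_lt_trans tb _; lra.
exists (fun t => t / sigma (eps / 2)), (eps / 2), (eps / 2 / sigma (eps / 2)); split=> //.
- by move=> s t _ st _; rewrite ler_pM2r// invr_gt0.
- move=> t t0 te; rewrite ger0_norm; last by rewrite divr_ge0// ltW.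
  by rewrite ler_pM2r ?invr_gt0// ltW.
- move=> s t s_gt st te; rewrite -mulrBl mulrCA ler_peMr ?subr_ge0// ler_pdivlMr// mul1r.
  by apply: anti; [exact: lt_le_trans st|exact: ltW|lra].
Qed.

End Desingularization.

(** * Norms, differentiability and elementary estimates on row vectors *)

Section RowVectors.

Variable R : realType.

Lemma row_norm_coord n (u : 'rV[R]_n) i : `|u ord0 i| <= `|u|.
Proof.
rewrite /Num.norm /= mx_normrE.
exact: (le_bigmax _ (fun ij : 'I_1 * 'I_n => `|u ij.1 ij.2|) (ord0, i)).
Qed.

Lemma row_norm_attained n (u : 'rV[R]_n) : u != 0 -> exists i, `|u| = `|u ord0 i|.
Proof.
rewrite -normr_eq0 => /mx_norm_neq0[[i j] uij]; exists j.
by rewrite [LHS]uij /= (ord1 i).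
Qed.

Lemma row_norm_le n (u : 'rV[R]_n) rho :
  0 <= rho -> (forall i, `|u ord0 i| <= rho) -> `|u| <= rho.
Proof.
move=> rho0 urho; have [->|/row_norm_attained[i ->]//] := eqVneq u 0.
by rewrite normr0.
Qed.

Lemma sqnorm_ge0 n (u : 'rV[R]_n) : 0 <= sqnorm u.
Proof. by apply: sumr_ge0 => i _; rewrite -expr2 sqr_ge0. Qed.

Lemma sqnorm0 n : sqnorm (0 : 'rV[R]_n) = 0.
Proof. by apply: big1 => i _; rewrite mxE mul0r. Qed.

Lemma sqnormD n (u v : 'rV[R]_n) : sqnorm (u + v) = sqnorm u + dotv u v *+ 2 + sqnorm v.
Proof.
rewrite /sqnorm /dotv -sumrMnl -!big_split; apply: eq_bigr => i _ /=.
by rewrite !mxE; ring.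
Qed.

Lemma sqr_norm_le_sqnorm n (u : 'rV[R]_n) : `|u| ^+ 2 <= sqnorm u.
Proof.
have [->|/row_norm_attained[i ->]] := eqVneq u 0.
  by rewrite normr0 expr0n sqnorm_ge0.
rewrite real_normK ?num_real// /sqnorm /dotv (bigD1 i)//= -expr2 lerDl.
by apply: sumr_ge0 => j _; rewrite -expr2 sqr_ge0.
Qed.

Lemma dotv_le n (u v : 'rV[R]_n) a b :
    (forall i, `|u ord0 i| <= a) -> (forall i, `|v ord0 i| <= b) ->
  dotv u v <= n%:R * (a * b).
Proof.
move=> ua vb; apply: (@le_trans _ _ (\sum_(i < n) a * b)).
  apply: ler_sum => i _; apply: le_trans (ler_norm _) _; rewrite normrM.
  exact: ler_pM.
by rewrite sumr_const card_ord mulr_natl.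
Qed.

Lemma differentiable_sum_seq (V : normedModType R) (I : Type) (r : seq I)
    (F : I -> V -> R) x :
  (forall i, differentiable (F i) x) -> differentiable (fun y => \sum_(i <- r) F i y) x.
Proof.
move=> dF; elim: r => [|i r IH].
  by under eq_fun do rewrite big_nil; exact: differentiable_cst.
by under eq_fun do rewrite big_cons; apply: differentiableD.
Qed.

Lemma differentiable_prod_seq (V : normedModType R) (I : Type) (r : seq I)
    (F : I -> V -> R) x :
  (forall i, differentiable (F i) x) -> differentiable (fun y => \prod_(i <- r) F i y) x.
Proof.
move=> dF; elim: r => [|i r IH].
  by under eq_fun do rewrite big_nil; exact: differentiable_cst.
by under eq_fun do rewrite big_cons; apply: differentiableM.
Qed.

Lemma differentiable_exp (V : normedModType R) (f : V -> R) k x :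
  differentiable f x -> differentiable (fun y => f y ^+ k) x.
Proof.
move=> df; elim: k => [|k IH]; first exact: differentiable_cst.
by under eq_fun do rewrite exprS; apply: differentiableM.
Qed.

Lemma differentiable_polyfun n (p : mpoly n R) x : differentiable (polyfun p) x.
Proof.
have -> : polyfun p = fun y => \sum_(m <- msupp p) mcoeff m p * \prod_i y ord0 i ^+ m i.
  by apply/funext => y; rewrite /polyfun mevalE.
apply: differentiable_sum_seq => m; apply: differentiableM; first exact: differentiable_cst.
apply: differentiable_prod_seq => i; apply: differentiable_exp.
exact: differentiable_coord.
Qed.

Lemma continuous_polyfun n (p : mpoly n R) : continuous (polyfun p).
Proof. by move=> x; apply/differentiable_continuous/differentiable_polyfun. Qed.

Lemma dotv_grad n (f : 'rV[R]_n -> R) x v :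
  differentiable f x -> dotv (grad f x) v = 'D_v f x.
Proof.
move=> df; rewrite deriveE// [in RHS](row_sum_delta v) linear_sum.
by apply: eq_bigr => i _; rewrite mxE deriveE// linearZ mulrC.
Qed.

(** A mean value bound. The exponent [k] instead of [k - 1], affordable since [1 <= B], lets
    [B ^+ k] cancel when the bound is compared with [B ^+ k] times a value of [f]. *)
Lemma expr_sub_le (A B : R) k : 0 <= A -> A <= B -> 1 <= B ->
  B ^+ k - A ^+ k <= k%:R * B ^+ k * (B - A).
Proof.
move=> A0 AB B1; have B0 : 0 <= B := le_trans ler01 B1.
elim: k => [|k IH]; first by rewrite !expr0 subrr !mul0r.
have -> : B ^+ k.+1 - A ^+ k.+1 = B * (B ^+ k - A ^+ k) + A ^+ k * (B - A).
  by rewrite !exprS; ring.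
have -> : k.+1%:R * B ^+ k.+1 * (B - A) =
    B * (k%:R * B ^+ k * (B - A)) + B ^+ k.+1 * (B - A).
  by rewrite -natr1 !exprS; ring.
apply: lerD; first exact: ler_wpM2l.
apply: ler_wpM2r; first by rewrite subr_ge0.
apply: (@le_trans _ _ (B ^+ k)); first by rewrite lerXn2r.
by rewrite exprS ler_peMl// exprn_ge0.
Qed.

End RowVectors.

(* The [C]-proximal slope of [f] at [x] relative to [X] is at most [sigma].
   Bounding the coordinates of [z - x] by [rho] keeps the condition polynomial. *)
Definition slope_le (R : realType) (n : nat) (X : set 'rV[R]_n) (f : 'rV[R]_n -> R)
    (C : R) (x : 'rV[R]_n) (sigma : R) : Prop :=
  forall z, X z -> forall rho, 0 <= rho -> (forall i, `|z ord0 i - x ord0 i| <= rho) ->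
    f x - f z <= sigma * rho + C * rho ^+ 2.

Definition tail (R : realType) (n : nat) (y : 'rV[R]_n.+1) : 'rV[R]_n :=
  \row_i y ord0 (lift ord0 i).

(** The slope bound is stored as coordinate 0 in front of the point, so that a lexicographic minimum
    starting there is a point of least slope on the level [c + t]. *)
Definition slope_family (R : realType) (n : nat) (X : set 'rV[R]_n) (f : 'rV[R]_n -> R)
    (C c t : R) : set 'rV[R]_n.+1 :=
  [set y | X (tail y) /\ 0 <= y ord0 ord0 <= 1 /\ f (tail y) = c + t /\
           slope_le X f C (tail y) (y ord0 ord0)].

(** * Definability and compactness of the slope family *)

Section SlopeFamily.

Variables (R : realType) (n : nat).
Implicit Types (X : set 'rV[R]_n) (p : mpoly n R).

(** The bound increases with [rho], so the least admissible [rho], the sup norm of [z - x], is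
    decisive. This form is continuous in [x] and serves for closedness. *)
Lemma slope_leP X (f : 'rV[R]_n -> R) C x sigma : 0 <= C -> 0 <= sigma ->
  slope_le X f C x sigma <->
  forall z, X z -> f x - f z <= sigma * `|z - x| + C * `|z - x| ^+ 2.
Proof.
move=> C0 sigma0; split=> H z Xz => [|rho rho0 zx].
  apply: H => // i.
  by have := row_norm_coord (z - x) i; rewrite !mxE.
have zx_le : `|z - x| <= rho by apply: row_norm_le => // i; rewrite !mxE.
apply: le_trans (H z Xz) _; apply: lerD; first exact: ler_wpM2l.
by apply: ler_wpM2l => //; rewrite lerXn2r// nnegrE.
Qed.

Lemma tail_vec (e : nat -> R) k : tail (vec n.+1 e k) = vec n e k.+1.
Proof. by apply/rowP => i; rewrite !mxE lift0 addSnnS. Qed.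

Lemma continuous_tail : continuous (@tail R n).
Proof.
move=> y; apply/(@cvgrPdist_lt _ _ _ (nbhs y) _ (@tail R n) (tail y)) => eps eps0.
have near_y := (@cvgrPdist_lt _ _ _ (nbhs y) _ id y).1 (@cvg_id _ _) eps eps0.
near=> w; apply: (@le_lt_trans _ _ `|y - w|); last by near: w; exact: near_y.
apply: row_norm_le => // i; rewrite !mxE.
by have := row_norm_coord (y - w) (lift ord0 i); rewrite !mxE.
Unshelve. all: by end_near. Qed.

Lemma definable_slope_le X p C k l : semialgebraic X ->
  definable (fun e => slope_le X (polyfun p) C (vec n e k) (e l)).
Proof.
(* Fresh variables: the block starting at [K] holds [z], and [r], just after it, holds [rho]. *)
move=> sX; pose K := maxn l.+1 (k + n); pose r := (K + n)%N.
have v i := @polynomial_term_var R i; have c x := @polynomial_term_const R x.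
pose diff (i : 'I_n) (e : nat -> R) := e (K + i)%N - e (k + i)%N.
have dist i : polynomial_term (diff i) := polynomial_termB (v _) (v _).
have := definable_allv K n (definable_imp (definable_semialgebraic K sX)
  (definable_all r (definable_imp (definable_le (c 0) (v r)) (definable_imp
    (definable_all_seq (enum 'I_n) (fun i => definable_and
      (definable_le (polynomial_termN (v r)) (dist i)) (definable_le (dist i) (v r))))
    (definable_le
      (polynomial_termB (polynomial_term_polyfun p k) (polynomial_term_polyfun p K))
      (polynomial_termD (polynomial_termM (v l) (v r))
        (polynomial_termM (c C) (polynomial_termX 2 (v r))))))))).
apply: eq_definable => e; rewrite /slope_le.
have lK : (l < K)%N by rewrite leq_maxl.
have kK : (k + n <= K)%N by rewrite leq_maxr.
have Kr : (K <= r)%N by exact: leq_addr.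
have E (w : 'rV[R]_n) rho (e1 := updv e K w) (e2 := upd e1 r rho) :
    [/\ vec n e1 K = w, vec n e2 K = w, vec n e2 k = vec n e k, e2 r = rho &
      e2 l = e l] /\ forall i, diff i e2 = w ord0 i - vec n e k ord0 i.
  have e2_lt j : (j < r)%N -> e2 j = e1 j by move=> jr; rewrite /e2 upd_neq// ltn_eqF.
  have e2_vec j : (j + n <= r)%N -> vec n e2 j = vec n e1 j.
    move=> jr; apply/rowP => i; rewrite !mxE e2_lt//.
    by apply: leq_trans jr; rewrite ltn_add2l.
  have e1K : vec n e1 K = w by exact: vec_updv.
  have e2k : vec n e2 k = vec n e k by rewrite e2_vec ?/e1 ?vec_updv_lt// (leq_trans kK).
  have e2K : vec n e2 K = w by rewrite e2_vec.
  split; first by split=> //; [exact: updE|rewrite e2_lt ?/e1 ?updv_lt// (leq_trans lK)].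
  by move=> i; rewrite -e2k -[in RHS]e2K !mxE.
split=> [H w Xw rho rho0 wrho|H w].
  have [[E1 E2 E3 E4 E5] E6] := E w rho; have := H w; rewrite E1 => /(_ Xw rho).
  rewrite E2 E3 E4 E5; apply=> // i _.
  by rewrite E6; apply/andP; rewrite -ler_norml.
have [[-> _ _ _ _] _] := E w 0 => Xw rho.
have [[_ -> -> -> ->] E6] := E w rho => rho0 wrho; apply: H => // i.
by rewrite ler_norml -E6; apply/andP; apply: wrho; rewrite mem_enum.
Qed.

Lemma definable_slope_family X p C c : semialgebraic X ->
  definable_family (slope_family X (polyfun p) C c).
Proof.
move=> sX i k; have v j := @polynomial_term_var R j; have cst x := @polynomial_term_const R x.
have := definable_and (definable_semialgebraic k.+1 sX)
  (definable_and (definable_and (definable_le (cst 0) (v k)) (definable_le (v k) (cst 1)))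
  (definable_and (definable_eq (polynomial_term_polyfun p k.+1) (polynomial_termD (cst c) (v i)))
     (definable_slope_le p C k.+1 k sX))).
apply: eq_definable => e; rewrite /slope_family /= tail_vec mxE addn0.
by split=> -[Xe [h [fe sl]]]; split=> //; split=> //; exact/andP.
Qed.

Lemma compact_slope_family X p C c t : 0 <= C -> compact X ->
  compact (slope_family X (polyfun p) C c t).
Proof.
move=> C0 cX; have [M [_ XM]] := compact_bounded cX.
have {}XM x : X x -> forall i, `|x ord0 i| <= M + 1.
  by move=> Xx i; apply: le_trans (row_norm_coord x i) _; apply: XM; rewrite ?ltrDl.
pose N := Num.max 1 (M + 1).
pose box := [set y : 'rV[R]_n.+1 | forall i, [set` `[- N, N]] (y ord0 i)].
have cbox : compact box := rV_compact (fun=> @segment_compact R (- N) N).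
have cont0 : continuous (fun y : 'rV[R]_n.+1 => y ord0 ord0).
  by move=> y; exact: coord_continuous.
have contf : continuous (fun y : 'rV[R]_n.+1 => polyfun p (tail y)).
  by move=> y; apply: continuous_comp; [exact: continuous_tail|exact: continuous_polyfun].
have cstc (x : R) : continuous (fun=> x : R) := fun y : 'rV[R]_n.+1 => @cst_continuous _ _ x y.
have clX : closed X by apply: compact_closed => //; exact: norm_hausdorff.
have cl1 : closed [set y | X (@tail R n y)].
  by apply: (@preimage_closed _ _ (@tail R n) X) => // y _; exact: continuous_tail.
have cl2 : closed [set y : 'rV[R]_n.+1 | 0 <= y ord0 ord0] by exact: closed_le_fun.
have cl3 : closed [set y : 'rV[R]_n.+1 | y ord0 ord0 <= 1] by exact: closed_le_fun.
have cl4 : closed [set y | polyfun p (@tail R n y) <= c + t] by exact: closed_le_fun.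
have cl5 : closed [set y | c + t <= polyfun p (@tail R n y)] by exact: closed_le_fun.
have clz z : closed [set y | polyfun p (@tail R n y) - polyfun p z <=
    y ord0 ord0 * `|z - @tail R n y| + C * `|z - @tail R n y| ^+ 2].
  have contN : continuous (fun y => `|z - @tail R n y|).
    move=> y; apply: (@cvg_norm _ _ _ (nbhs y) _ (fun w => z - tail w) (z - tail y)).
    apply: (@cvgB _ _ _ (nbhs y) _ (fun=> z) (@tail R n) z (tail y)); first exact: cvg_cst.
    exact: continuous_tail.
  have contl : continuous (fun y => polyfun p (@tail R n y) - polyfun p z).
    by move=> y; exact: (continuousB (contf y) (cstc _ y)).
  apply: closed_le_fun contl _ => y.
  have contS := continuousM (cont0 y) (contN y).
  exact: (continuousD contS (continuousM (cstc C y) (continuousM (contN y) (contN y)))).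
apply: (subclosed_compact _ cbox); last first.
  move=> y [Xy [/andP[y0 y1] _]] i; rewrite /= in_itv /= -ler_norml.
  case: (unliftP ord0 i) => [j|] ->; last first.
    by rewrite ger0_norm// le_max y1.
  by have := XM _ Xy j; rewrite mxE => yM; rewrite le_max yM orbT.
have -> : slope_family X (polyfun p) C c t =
    ([set y | X (@tail R n y)] `&` [set y : 'rV[R]_n.+1 | 0 <= y ord0 ord0]
      `&` [set y : 'rV[R]_n.+1 | y ord0 ord0 <= 1]
      `&` [set y | polyfun p (@tail R n y) <= c + t]
      `&` [set y | c + t <= polyfun p (@tail R n y)]) `&`
    \bigcap_(z in X) [set y | polyfun p (@tail R n y) - polyfun p z <=
       y ord0 ord0 * `|z - @tail R n y| + C * `|z - @tail R n y| ^+ 2].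
  apply/seteqP; split=> y /=.
    move=> [Xy [/andP[y0 y1] [fy /(slope_leP _ _ _ C0 y0) slope]]].
    by do !split=> //=; rewrite fy.
  move=> [[[[[Xy y0] y1] fy1] fy2] slope]; do !split=> //; first by apply/andP.
    by apply/le_anti/andP.
  exact/slope_leP.
by apply: closedI; [do !apply: closedI|exact: closed_bigI].
Qed.

End SlopeFamily.

(** The function [U] is built along the curve of least slope, yet applies to every point [x] of
    small slope: the curve has on the level of [x] a slope no larger than [sigma]. *)
Lemma slope_desingularization (R : realType) (n : nat) (X : set 'rV[R]_n)
    (p : mpoly n R) (C c : R) :
    compact X -> semialgebraic X -> 0 <= C ->
    (forall eps, 0 < eps -> exists x sigma, [/\ X x, 0 <= sigma <= 1,
      c < polyfun p x < c + eps & slope_le X (polyfun p) C x sigma]) ->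
  exists U eps B, [/\ 0 < eps,
    forall s t, 0 < s -> s <= t -> t < eps -> U s <= U t,
    forall t, 0 < t -> t < eps -> `|U t| <= B &
    forall s x sigma, X x -> 0 <= sigma <= 1 -> slope_le X (polyfun p) C x sigma ->
      0 < s -> c + s <= polyfun p x -> polyfun p x < c + eps ->
      polyfun p x - c - s <= sigma * (U (polyfun p x - c) - U s)].
Proof.
move=> cX sX C0 acc; pose W := slope_family X (polyfun p) C c.
have [M [_ XM]] := compact_bounded cX.
have {}XM x : X x -> forall i, `|x ord0 i| <= M + 1.
  by move=> Xx i; apply: le_trans (row_norm_coord x i) _; apply: XM; rewrite ?ltrDl.
pose B := Num.max 1 (M + 1).
have B0 : 0 <= B by rewrite le_max ler01.
have WB t y i : W t y -> `|y ord0 i| <= B.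
  move=> [Xy [/andP[y0 y1] _]]; case: (unliftP ord0 i) => [j|] ->; last first.
    by rewrite ger0_norm// le_max y1.
  by have := XM _ Xy j; rewrite mxE => yM; rewrite le_max yM orbT.
have Wacc eps : 0 < eps -> exists t, 0 < t < eps /\ W t !=set0.
  move=> /acc[x [sigma [Xx s01 /andP[cx xe] slope]]]; exists (polyfun p x - c).
  split; first by rewrite subr_gt0 cx ltrBlDl.
  pose y : 'rV[R]_n.+1 := \row_i (if unlift ord0 i is Some j then x ord0 j else sigma).
  have tE : tail y = x by apply/rowP => i; rewrite !mxE liftK.
  have y0 : y ord0 ord0 = sigma by rewrite mxE unlift_none.
  by exists y; rewrite /W /slope_family /= tE y0 subrKC.
have [y [eps [eps0 [Wy mono]]]] := monotone_selection ord0
  (definable_slope_family p C c sX) (fun t => @compact_slope_family _ _ X p C c t C0 cX)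
  B0 WB Wacc.
(* The sign records the direction in which coordinate [i] moves; with it the increments of [V] are
   the l1 lengths of the chords of the curve. *)
have /choice[sgn sgnP] : forall i : 'I_n, exists g : R, `|g| = 1 /\
    forall s t, 0 < s -> s <= t -> t < eps ->
      g * (tail (y t) ord0 i - tail (y s) ord0 i) = `|tail (y t) ord0 i - tail (y s) ord0 i|.
  move=> i; case: (mono (lift ord0 i)) => H; [exists 1|exists (-1)];
      rewrite ?normrN normr1; split=> // s t s0 st te; rewrite !mxE.
    by rewrite mul1r ger0_norm// subr_ge0 H.
  by rewrite mulN1r ler0_norm// subr_le0 H.
pose V t := \sum_i sgn i * tail (y t) ord0 i.
have VE s t : 0 < s -> s <= t -> t < eps ->
    V t - V s = \sum_i `|tail (y t) ord0 i - tail (y s) ord0 i|.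
  move=> s0 st te; rewrite /V -sumrB; apply: eq_bigr => i _.
  by rewrite -mulrBr; case: (sgnP i) => _ ->.
have V0 s t : 0 < s -> s <= t -> t < eps -> 0 <= V t - V s.
  by move=> s0 st te; rewrite VE// sumr_ge0.
pose sigma t := y t ord0 ord0.
have [||||U [eps' [B' [eps'0 Um UB UP]]]] :=
    @desingularization R V sigma C (n%:R * B) eps eps0 C0 _ _ _ _ (mono ord0).
- by move=> t t0 te; have [[_ [/andP[]]]] := Wy t t0 te.
- move=> t t0 te; have [Wyt _] := Wy t t0 te; apply: le_trans (ler_norm_sum _ _ _) _.
  apply: (@le_trans _ _ (\sum_(i < n) B)); last by rewrite sumr_const card_ord mulr_natl.
  apply: ler_sum => i _; rewrite normrM (sgnP i).1 mul1r mxE; exact: WB Wyt.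
- by move=> s t s0 st te; rewrite -subr_ge0 V0.
(* The slope condition at the point of level [c + t], tested against the point of level [c + s],
   with [rho] the increment of [V]. *)
- move=> s t s0 st te; have t0 := lt_le_trans s0 st.
  have [[_ [_ [ft slope]]] _] := Wy t t0 te.
  have [[Xs [_ [fs _]]] _] := Wy s s0 (le_lt_trans st te).
  have := slope _ Xs (V t - V s) (V0 s t s0 st te); rewrite ft fs.
  have -> : c + t - (c + s) = t - s by lra.
  apply=> i; rewrite distrC VE// (bigD1 i)//= lerDl.
  exact: sumr_ge0.
- exists U, (Num.min eps eps'), B'; split.
  + by rewrite lt_min eps0.
  + by move=> s t s0 st; rewrite lt_min => /andP[_]; exact: Um.
  + by move=> t t0; rewrite lt_min => /andP[_]; exact: UB.
  + move=> s x sg Xx s01 slope s0 sx xe; set t := polyfun p x - c.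
    have st : s <= t by rewrite /t lerBrDl.
    have t0 := lt_le_trans s0 st.
    have : t < Num.min eps eps' by rewrite /t ltrBlDl.
    rewrite lt_min => /andP[te te'].
    have [_ smin] := Wy t t0 te.
    pose w : 'rV[R]_n.+1 := \row_i (if unlift ord0 i is Some j then x ord0 j else sg).
    have tE : tail w = x by apply/rowP => i; rewrite !mxE liftK.
    have w0 : w ord0 ord0 = sg by rewrite mxE unlift_none.
    have Ww : W t w by rewrite /W /slope_family /= tE w0 subrKC.
    have := smin w Ww; rewrite w0 => sg_le.
    apply: le_trans (UP s t s0 st te') _; apply: ler_wpM2r => //.
    by rewrite subr_ge0 Um.
Qed.

(** * The iteration *)

Section Iteration.

Variables (R : realType) (n : nat).
Implicit Types (X : set 'rV[R]_n) (f : 'rV[R]_n -> R).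

Lemma argminP X (phi : 'rV[R]_n -> R) : X !=set0 -> compact X -> continuous phi ->
  X (argmin X phi) /\ forall x, X x -> phi (argmin X phi) <= phi x.
Proof.
move=> X0 cX cphi.
have [c + cmin] := compact_EVT_min X0 cX (continuous_subspaceT cphi); rewrite inE => Xc.
apply: (@xgetI _ 0 [set a | X a /\ forall x, X x -> phi a <= phi x] c); split=> // x Xx.
by apply: cmin; rewrite inE.
Qed.

Lemma sqnorm_ge1 (u : 'rV[R]_n) : 1 <= 1 + sqnorm u.
Proof. by rewrite lerDl sqnorm_ge0. Qed.

(** The weight is at least [1 + sqnorm (b - a)], since [N] is positive; its excess over 1,
    multiplied by [f b >= m], is what [f] must lose. *)
Lemma descent f N m a b : (0 < N)%N -> 0 <= m -> m <= f b ->
  convexified f N a b <= f a -> m * `|b - a| ^+ 2 <= f a - f b.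
Proof.
move=> N0 m0 mf; rewrite /convexified => le_fa.
have f0 : 0 <= f b := le_trans m0 mf.
have le1 : 1 + sqnorm (b - a) <= (1 + sqnorm (b - a)) ^+ N.
  by rewrite -{1}[1 + _]expr1 ler_weXn2l// sqnorm_ge1.
have : (1 + sqnorm (b - a)) * f b <= f a by apply: le_trans le_fa; rewrite ler_wpM2r.
have : m * `|b - a| ^+ 2 <= f b * sqnorm (b - a).
  by apply: ler_pM => //; exact: sqr_norm_le_sqnorm.
rewrite mulrDl mul1r [f b * _]mulrC; lra.
Qed.

(** Minimality compares [A ^+ N * f b] with [B ^+ N * f z], so [f b - f z] is at most
    [N * M * (B - A)], and expanding the square in [B] gives a linear and a quadratic term in [rho].
    The factor [n] comes from bounding inner products coordinatewise; the quadratic coefficient is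
    rounded up to equal the linear one. *)
Lemma slope_le_argmin X f N M a b : X b -> (forall x, X x -> 0 <= f x <= M) ->
    (forall z, X z -> convexified f N a b <= convexified f N a z) ->
  slope_le X f (2 * n%:R * (N%:R * M)) b (2 * n%:R * (N%:R * M) * `|b - a|).
Proof.
move=> Xb fM bmin z Xz rho rho0 zb; have := bmin z Xz; rewrite /convexified.
set A := 1 + sqnorm (b - a); set B := 1 + sqnorm (z - a) => AB.
have [/andP[fb0 fbM] /andP[fz0 fzM]] := (fM b Xb, fM z Xz).
have A1 : 1 <= A := sqnorm_ge1 _; have B1 : 1 <= B := sqnorm_ge1 _.
have A0 : 0 <= A := le_trans ler01 A1; have B0 : 0 <= B := le_trans ler01 B1.
have M0 : 0 <= M := le_trans fb0 fbM.
set d := `|b - a|; have d0 : 0 <= d by exact: normr_ge0.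
have RHS0 : 0 <= 2 * n%:R * (N%:R * M) * d * rho + 2 * n%:R * (N%:R * M) * rho ^+ 2.
  by rewrite addr_ge0// !mulr_ge0// ?exprn_ge0.
(* If [z] is no farther from [a] than [b] is, minimality already forces [f b <= f z]. *)
have [BA|/ltW leAB] := leP B A.
  apply: le_trans RHS0; rewrite subr_le0.
  have AN0 : 0 < A ^+ N by rewrite exprn_gt0// (lt_le_trans ltr01).
  rewrite -(ler_pM2l AN0); apply: le_trans AB _; apply: ler_wpM2r => //.
  by rewrite lerXn2r.
have BN0 : 0 < B ^+ N by rewrite exprn_gt0// (lt_le_trans ltr01).
have fbz : f b - f z <= N%:R * M * (B - A).
  apply: (@le_trans _ _ (N%:R * f b * (B - A))); last first.
    by apply: ler_wpM2r; [rewrite subr_ge0|exact: ler_wpM2l].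
  rewrite -(ler_pM2l BN0) mulrBr.
  have := ler_wpM2r fb0 (expr_sub_le N A0 leAB B1); rewrite mulrBl => le_fb.
  apply: (@le_trans _ _ (B ^+ N * f b - A ^+ N * f b)); first by rewrite lerD2l lerN2.
  by apply: le_trans le_fb _; rewrite le_eqVlt; apply/orP; left; apply/eqP; ring.
apply: le_trans fbz _.
have -> : 2 * n%:R * (N%:R * M) * d * rho + 2 * n%:R * (N%:R * M) * rho ^+ 2 =
    N%:R * M * (n%:R * (d * rho) *+ 2 + n%:R * (rho * rho) *+ 2) by ring.
apply: ler_wpM2l; first by rewrite mulr_ge0.
have zbi i : `|(z - b) ord0 i| <= rho by rewrite !mxE.
have le1 := dotv_le (row_norm_coord (b - a)) zbi.
have le2 : sqnorm (z - b) <= n%:R * (rho * rho) := dotv_le zbi zbi.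
have rr0 : 0 <= n%:R * (rho * rho) by rewrite !mulr_ge0.
have -> : B - A = dotv (b - a) (z - b) *+ 2 + sqnorm (z - b).
  have zaE : z - a = (b - a) + (z - b) by rewrite [RHS]addrC addrA subrK.
  by rewrite /B /A zaE sqnormD; ring.
apply: lerD; first by rewrite lerMn2r.
by apply: le_trans le2 _; rewrite mulr2n lerDl.
Qed.

(** Summing the recurrence bounds a partial sum by half of the previous one plus a telescoped term,
    and the half is absorbed on the left. *)
Lemma sum_le_of_recurrence (d w : nat -> R) b : (forall k, 0 <= d k) -> (forall k, b <= w k) ->
    (forall k, d k.+1 <= d k / 2 + (w k - w k.+1)) ->
  forall k, \sum_(0 <= i < k) d i <= 2 * (d 0%N + w 0%N - b).
Proof.
move=> d0 wb rec k; pose S k := \sum_(0 <= i < k) d i.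
have H : S k.+1 <= d 0%N + S k / 2 + (w 0%N - w k).
  elim: k => [|k IH]; first by rewrite /S big_nat1 big_geq// mul0r !addr0 subrr addr0.
  have SS j : S j.+1 = S j + d j by rewrite /S big_nat_recr.
  by rewrite SS [in X in _ <= X]SS; have := rec k; lra.
have : S k <= S k.+1 by rewrite /S big_nat_recr//= lerDl.
have := wb k; rewrite -/(S k); lra.
Qed.

Lemma is_cvg_row (u : nat -> 'rV[R]_n) :
  (forall i, cvgn (fun k => u k ord0 i)) -> cvgn u.
Proof.
move=> cu; apply/cvg_ex; exists (\row_i limn (fun k => u k ord0 i)).
apply/cvgrPdist_lt => eps eps0.
have : \forall k \near \oo, forall i, `|limn (fun k => u k ord0 i) - u k ord0 i| < eps.
  by apply: filter_forall => i; have /cvgrPdist_lt := cu i; exact.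
apply: filterS => k uk; set w := _ - u k.
have [->|/row_norm_attained[i ->]] := eqVneq w 0; first by rewrite normr0.
by rewrite !mxE.
Qed.

(** In each coordinate the telescoping series of the tail from [K] on converges absolutely. *)
Lemma cvg_of_bounded_length (u : nat -> 'rV[R]_n) K B :
  (forall k, \sum_(0 <= i < k) `|u (K + i.+1)%N - u (K + i)%N| <= B) ->
  cvgn u.
Proof.
move=> uB; apply: is_cvg_row => i.
pose v k := u (k + K)%N ord0 i; have vE k : v k = u (K + k)%N ord0 i by rewrite /v addnC.
have cs : cvgn [normed series (telescope v)].
  apply: nondecreasing_is_cvgn.
    by apply/nondecreasing_seqP => k; rewrite /normed_series_of /series /= big_nat_recr//= lerDl.
  exists B => _ [k _ <-]; rewrite /series /=; apply: le_trans (uB k).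
  apply: ler_sum => j _; rewrite /telescope /= !vE.
  by have := row_norm_coord (u (K + j.+1)%N - u (K + j)%N) i; rewrite !mxE.
have : cvgn v.
  have := normed_cvg cs; rewrite telescopeK => cv.
  have -> : v = (fun k => (v k - v 0%N) + v 0%N) by apply/funext => k; rewrite subrK.
  by apply: is_cvgD => //; exact: is_cvg_cst.
move=> /cvg_ex[l vl]; apply/cvg_ex; exists l; rewrite -(cvg_shiftn K); exact: vl.
Qed.

End Iteration.

(** * First-order condition at the limit *)

Section LowerCritical.

Variables (R : realType) (n : nat).
Implicit Types (X : set 'rV[R]_n).

Lemma convex_set_segment X (x y : 'rV[R]_n) h : convex_set X -> X x -> X y ->
  0 <= h -> h <= 1 -> X (h *: (y - x) + x).
Proof.
move=> cX Xx Xy h0 h1.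
have h01 : 0 <= h <= 1 by rewrite h0.
have := cX y x (Itv01 h0 h1); rewrite !inE => /(_ Xy Xx).
suff -> : conv (Itv01 h0 h1) (y : convex_lmodType _) (x : convex_lmodType _) =
    h *: (y - x) + x by [].
rewrite /conv /=; by rewrite /unstable.onem scalerBl scale1r scalerBr addrA addrAC.
Qed.

(** On the segment from [l] towards [x] the weight exceeds 1 only by a multiple of [h ^+ 2], so it
    disappears from the one-sided derivative of [f] at [l]. Convexity keeps the segment in [X], and
    the inequality is obtained for every [x] in [X]. *)
Lemma lower_critical_of_min X p N (l : 'rV[R]_n) : convex_set X -> compact X ->
    (forall x, X x -> 0 < polyfun p x) -> X l ->
    (forall z, X z -> polyfun p l <= convexified (polyfun p) N l z) ->
  lower_critical X (polyfun p) l.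
Proof.
move=> cvX cX f0 Xl lmin; set f := polyfun p; split=> //.
apply: (@filterE _ (nbhs l)) => x Xx; set v := x - l.
rewrite dotv_grad; last exact: differentiable_polyfun.
have [cM XcM cMmax] := compact_EVT_max (ex_intro _ l Xl) cX
  (continuous_subspaceT (@continuous_polyfun R n p)).
have {}cMmax z : X z -> f z <= f cM by move=> Xz; apply: cMmax; rewrite inE.
set M := f cM in cMmax.
have M0 : 0 <= M by apply: le_trans (cMmax l Xl); exact/ltW/f0.
pose q := sqnorm v; have q0 : 0 <= q := sqnorm_ge0 v.
(* For [h] below 1 the weight is at most [(1 + q) ^+ N], so [expr_sub_le] bounds its excess over 1
   by [N * (1 + q) ^+ N * (h ^+ 2 * q)]; the factor [M] bounds [f]. *)
pose K := N%:R * (1 + q) ^+ N * q * M.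
have K0 : 0 <= K by rewrite !mulr_ge0// exprn_ge0// addr_ge0.
have lower h : 0 < h -> h < 1 -> - (K * h) <= h^-1 *: (f (h *: v + l) - f l).
  move=> h0 h1; set z := h *: v + l.
  have Xz : X z by apply: convex_set_segment => //; exact: ltW.
  have fz0 : 0 <= f z by apply/ltW/f0.
  have zE : sqnorm (z - l) = h ^+ 2 * q.
    rewrite /z addrK /q /sqnorm /dotv mulr_sumr; apply: eq_bigr => i _.
    by rewrite !mxE; ring.
  have := lmin z Xz; rewrite /convexified zE; set B := 1 + h ^+ 2 * q => le_fl.
  have hq0 : 0 <= h ^+ 2 * q by rewrite mulr_ge0// exprn_ge0// ltW.
  have hq1 : h ^+ 2 * q <= q by rewrite ler_piMl// expr_le1// ltW.
  have B1 : 1 <= B by rewrite lerDl.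
  have BN := expr_sub_le N ler01 B1 B1.
  have BE : B - 1 = h ^+ 2 * q by rewrite /B; ring.
  have BBq : B ^+ N <= (1 + q) ^+ N.
    by rewrite lerXn2r ?nnegrE ?addr_ge0// lerD2l.
  have : f l - f z <= K * h ^+ 2.
    apply: (@le_trans _ _ ((B ^+ N - 1) * f z)); first by rewrite mulrBl mul1r lerD2r.
    rewrite expr1n BE in BN; apply: le_trans (ler_wpM2r fz0 BN) _.
    have -> : K * h ^+ 2 = N%:R * (1 + q) ^+ N * (h ^+ 2 * q) * M by rewrite /K; ring.
    have BN0 : 0 <= B ^+ N by rewrite exprn_ge0// (le_trans ler01).
    have L0 : 0 <= N%:R * B ^+ N * (h ^+ 2 * q) by do ![apply: mulr_ge0 => //].
    apply: (ler_pM L0 fz0 _ (cMmax z Xz)); apply: ler_wpM2r => //.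
    by apply: ler_wpM2l.
  move=> le_K; rewrite -(ler_pM2l h0) /GRing.scale /= mulrA mulfV ?gt_eqF// mul1r.
  have -> : h * - (K * h) = - (K * h ^+ 2) by ring.
  by rewrite lerNl opprB.
have df : derivable f l v by apply: diff_derivable; exact: differentiable_polyfun.
have cvD := cvg_dnbhs_at_right df.
have cvK : - (K * h) @[h --> 0^'+] --> (0 : R).
  have := @cvgN _ _ _ (nbhs (0 : R)) _ _ _ (@mulrl_continuous R K 0).
  rewrite mulr0 oppr0 => /(_ (nbhs_filter _)) cvN.
  exact: (@cvg_at_right_filter R R (fun h => - (K * h)) 0 0 cvN).
apply: (ler_cvg_to cvK cvD); near=> h; apply: lower; near: h.
  exact: nbhs_right_gt.
exact: nbhs_right_lt.
Unshelve. all: by end_near. Qed.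

End LowerCritical.

(** * Convergence of the iterates *)

Section Convergence.

Variables (R : realType) (n : nat).
Implicit Types (X : set 'rV[R]_n) (p : mpoly n R).

Lemma continuous_convexified p N xi : continuous (convexified (polyfun p) N xi).
Proof.
move=> x; apply/differentiable_continuous; rewrite /convexified /sqnorm /dotv.
apply: differentiableM; last exact: differentiable_polyfun.
apply: differentiable_exp; apply: differentiableD; first exact: differentiable_cst.
have dB i : differentiable (fun y : 'rV[R]_n => (y - xi) ord0 i) x.
  under eq_fun do rewrite !mxE.
  by apply: differentiableD; [exact: differentiable_coord|exact: differentiable_cst].
by apply: differentiable_sum_seq => i; apply: differentiableM.
Qed.

Lemma continuous_convexified_center p N z :
  continuous (fun xi => convexified (polyfun p) N xi z).
Proof.
move=> x; apply/differentiable_continuous; rewrite /convexified /sqnorm /dotv.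
apply: differentiableM; last exact: differentiable_cst.
apply: differentiable_exp; apply: differentiableD; first exact: differentiable_cst.
have dB i : differentiable (fun y : 'rV[R]_n => (z - y) ord0 i) x.
  under eq_fun do rewrite !mxE.
  by apply: differentiableB; [exact: differentiable_cst|exact: differentiable_coord].
by apply: differentiable_sum_seq => i; apply: differentiableM.
Qed.

(** The arithmetic-geometric mean inequality for [d] and [C / m * e]; the coefficient 1/2 of [d] is
    what makes the resulting recurrence summable. *)
Lemma le_half_add (m C d e x : R) : 0 < m -> 0 <= C -> 0 <= d -> 0 <= e -> 0 <= x ->
  m * x ^+ 2 <= C * d * e -> x <= d / 2 + C / (2 * m) * e.
Proof.
move=> m0 C0 d0 e0 x0 le_x; set E := C / m * e.
have E0 : 0 <= E by rewrite mulr_ge0// divr_ge0// ltW.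
have -> : C / (2 * m) * e = E / 2 by rewrite /E; field; rewrite gt_eqF.
rewrite -mulrDl -(@ler_sqr _ x) ?nnegrE ?divr_ge0 ?addr_ge0//.
apply: (@le_trans _ _ (d * E)).
  rewrite -(ler_pM2l m0); apply: le_trans le_x _; rewrite le_eqVlt; apply/orP; left.
  by apply/eqP; rewrite /E; field; rewrite gt_eqF.
rewrite -subr_ge0; have -> : ((d + E) / 2) ^+ 2 - d * E = (d - E) ^+ 2 / 4 by field.
by rewrite divr_ge0// sqr_ge0.
Qed.

Lemma cvg_argmin_iter X p N (a : nat -> 'rV[R]_n) :
    compact X -> semialgebraic X -> (forall x, X x -> 0 < polyfun p x) -> (0 < N)%N ->
    (forall nu, X (a nu)) ->
    (forall nu z, X z ->
      convexified (polyfun p) N (a nu) (a nu.+1) <= convexified (polyfun p) N (a nu) z) ->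
  cvgn a.
Proof.
move=> cX sX f0 N0 aX amin; set f := polyfun p in f0 amin *.
have Xne : X !=set0 by exists (a 0%N).
have cf : {within X, continuous f} := continuous_subspaceT (@continuous_polyfun R n p).
have [x1 + x1min] := compact_EVT_min Xne cX cf; rewrite inE => Xx1.
have [x2 + x2max] := compact_EVT_max Xne cX cf; rewrite inE => Xx2.
pose m := f x1; pose M := f x2; have m0 : 0 < m := f0 _ Xx1.
have fM x : X x -> 0 <= f x <= M.
  by move=> Xx; rewrite ltW ?f0//= /M x2max// inE.
have mf x : X x -> m <= f x by move=> Xx; apply: x1min; rewrite inE.
pose C := 2 * n%:R * (N%:R * M).
have C0 : 0 <= C by rewrite !mulr_ge0// ltW// f0.
pose d nu := `|a nu.+1 - a nu|; have d0 nu : 0 <= d nu by exact: normr_ge0.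
have desc nu : m * d nu ^+ 2 <= f (a nu) - f (a nu.+1).
  apply: (@descent _ _ f N) => //; [exact: ltW|exact: mf|].
  have self : convexified f N (a nu) (a nu) = f (a nu).
    by rewrite /convexified subrr sqnorm0 addr0 expr1n mul1r.
  by have := amin nu _ (aX nu); rewrite self.
have slope nu : slope_le X f C (a nu.+1) (C * d nu).
  by apply: slope_le_argmin => // z; exact: amin.
have md0 nu : 0 <= m * d nu ^+ 2 by rewrite mulr_ge0 ?exprn_ge0// ltW.
have fa_anti : {homo (f \o a) : i j / (i <= j)%N >-> j <= i}.
  by apply/nonincreasing_seqP => nu /=; rewrite -subr_ge0 (le_trans (md0 nu)).
have fa_cvg : cvgn (f \o a).
  by apply: nonincreasing_is_cvgn => //; exists m => _ [nu _ <-]; exact: mf.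
pose c := limn (f \o a).
have fc nu : c <= f (a nu) := nonincreasing_cvgn_ge fa_anti fa_cvg nu.
have fa_lt eps : 0 < eps -> exists K, forall nu, (K <= nu)%N -> f (a nu) < c + eps.
  move=> eps0; have /cvgrPdist_lt/(_ eps eps0)[K _ HK] := fa_cvg; exists K => nu Knu.
  by have := HK nu Knu; rewrite /= distrC ger0_norm ?subr_ge0 ?fc// ltrBlDl.
(* Desingularization needs levels strictly above [c]. If the limit value is attained, [f] is
   constant along the sequence from there on, and the descent inequality makes all later steps 0. *)
have [[k fk]|nfk] := pselect (exists k, f (a k) <= c).
  apply: (@cvg_of_bounded_length _ _ a k 0) => j; rewrite big1// => i _.
  have := desc (k + i)%N; have := fc (k + i).+1.
  have : f (a (k + i)%N) <= c by apply: le_trans fk; exact: fa_anti (leq_addr _ _).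
  rewrite addnS -/(d (k + i)%N) => h1 h2 h3.
  have : m * d (k + i)%N ^+ 2 <= 0 by lra.
  by rewrite pmulr_rle0// real_exprn_even_le0 ?num_real//= => /eqP.
have {}nfk k : c < f (a k) by rewrite ltNge; apply/negP => fk; apply: nfk; exists k.
(* Chosen so that [m * d nu ^+ 2 <= e1] implies [C * d nu <= 1], the cap on the slopes. *)
pose e1 := m / (C ^+ 2 + 1).
have C10 : 0 < C ^+ 2 + 1 by rewrite ltr_wpDl// sqr_ge0.
have e10 : 0 < e1 by rewrite divr_gt0.
have small nu : f (a nu) < c + e1 -> 0 <= C * d nu <= 1.
  move=> fe; have Cd0 : 0 <= C * d nu by exact: mulr_ge0.
  rewrite Cd0 -(@expr_le1 _ 2)// exprMn.
  have := desc nu; have := fc nu.+1 => h1 h2.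
  have : m * d nu ^+ 2 <= e1 by lra.
  rewrite /e1 ler_pdivlMr// -mulrA -[leRHS]mulr1 ler_pM2l// => h3.
  apply: le_trans h3; rewrite mulrDr mulr1 mulrC lerDl; exact: sqr_ge0.
have [|U [eps [B [eps0 Umono UB UP]]]] := @slope_desingularization R n X p C c cX sX C0.
  move=> eps eps0; have [K HK] := fa_lt (Num.min eps e1) ltac:(by rewrite lt_min eps0).
  have [+ +] := (HK K (leqnn K), HK K.+1 (leqnSn K)).
  rewrite -!ltrBlDl !lt_min !ltrBlDl => /andP[_ K1] /andP[K2 _].
  by exists (a K.+1), (C * d K); split; rewrite ?small// nfk.
have [K HK] := fa_lt (Num.min eps e1) ltac:(by rewrite lt_min eps0).
have {}HK nu : (K <= nu)%N -> f (a nu) < c + eps /\ 0 <= C * d nu <= 1.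
  move=> /HK; rewrite -ltrBlDl lt_min !ltrBlDl => /andP[h1 h2]; split=> //.
  exact: small.
pose w j := C / (2 * m) * U (f (a (K + j).+1) - c).
have Cm0 : 0 <= C / (2 * m) by rewrite divr_ge0// mulr_ge0// ltW.
have wB j : - (C / (2 * m) * B) <= w j.
  rewrite /w -mulrN ler_wpM2l//; have [h _] := HK (K + j).+1 (leqW (leq_addr _ _)).
  have := UB (f (a (K + j).+1) - c); rewrite ler_norml subr_gt0 ltrBlDl.
  by move=> /(_ (nfk _) h)/andP[].
(* The step out of [a k.+1] is controlled by the decrease of [f] there, hence by the slope at
   [a k.+1] times an increment of [U]; that slope is [C] times the preceding step. *)
have rec j : d (K + j.+1)%N <= d (K + j)%N / 2 + (w j - w j.+1).
  rewrite /w -mulrBr addnS; set k := (K + j)%N.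
  have [h1 _] := HK k.+1 (leqW (leq_addr _ _)); have [_ h2] := HK k (leq_addr _ _).
  apply: le_half_add => //.
    rewrite subr_ge0; apply: Umono; rewrite ?subr_gt0 ?nfk ?ltrBlDl ?lerB//.
    exact: fa_anti (leqnSn _).
  apply: le_trans (desc k.+1) _.
  have := UP (f (a k.+2) - c) (a k.+1) _ (aX _) h2 (slope k).
  rewrite subr_gt0 subrKC => /(_ (nfk _) (fa_anti _ _ (leqnSn _)) h1).
  by rewrite opprB addrA subrK.
apply: (@cvg_of_bounded_length _ _ a K (2 * (d (K + 0)%N + w 0%N + C / (2 * m) * B))) => k.
have := @sum_le_of_recurrence R (fun j => d (K + j)%N) w _ (fun j => d0 _) wB rec k.
by rewrite opprK; under eq_bigr do rewrite /d -addnS.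
Qed.

End Convergence.

Theorem theorem6p5 (R : realType) (n : nat) (X : set 'rV[R]_n)
    (f : mpoly n R) (N : nat) (mu : R) (a0 : 'rV[R]_n)
    (X_nonempty : X !=set0)
    (X_compact : compact X)
    (X_convex : convex_set X)
    (X_semialgebraic : semialgebraic X)
    (f_pos : forall x, X x -> 0 < polyfun f x)
    (N_pos : (0 < N)%N)
    (mu_pos : 0 < mu)
    (phi_sconvex : forall xi, X xi ->
      strongly_convex mu X (convexified (polyfun f) N xi))
    (Xa0 : X a0) :
  exists a : 'rV[R]_n,
    argmin_iter X (polyfun f) N a0 nu @[nu --> \oo] --> a /\
    lower_critical X (polyfun f) a.
Proof.
pose a nu := argmin_iter X (polyfun f) N a0 nu; pose F := polyfun f.
have aS nu : a nu.+1 = argmin X (convexified F N (a nu)) by [].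
have aX nu : X (a nu).
  by case: nu => // nu; rewrite aS; case: (argminP X_nonempty X_compact
    (@continuous_convexified R n f N (a nu))).
have amin nu z : X z -> convexified F N (a nu) (a nu.+1) <= convexified F N (a nu) z.
  by move=> Xz; rewrite aS; case: (argminP X_nonempty X_compact
    (@continuous_convexified R n f N (a nu))) => _; apply.
have cvg_a : cvgn a := cvg_argmin_iter X_compact X_semialgebraic f_pos N_pos aX amin.
have /cvg_ex[l al] := cvg_a; exists l; split=> //.
have clX : closed X by apply: compact_closed => //; exact: norm_hausdorff.
have Xl : X l by apply: (closed_cvg X clX _ l al); exact: nearW.
apply: (lower_critical_of_min X_convex X_compact f_pos Xl) => z Xz.
(* The weight at [a nu.+1] is at least 1 and is dropped from the left side of minimality. The limit
   then uses continuity of [f], and continuity of the weighted function in its center for fixed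
   [z]. *)
have cvF : F (a nu.+1) @[nu --> \oo] --> F l.
  have := cvg_comp _ _ al (@continuous_polyfun R n f l).
  by rewrite -(cvg_shiftS (F \o a)).
have cvz : convexified F N (a nu) z @[nu --> \oo] --> convexified F N l z.
  exact: cvg_comp _ _ al (@continuous_convexified_center R n f N z l).
apply: (ler_cvg_to cvF cvz); apply: nearW => nu.
apply: le_trans (amin nu z Xz); rewrite /convexified ler_peMl//.
  exact/ltW/f_pos.
by rewrite exprn_ege1// sqnorm_ge1.
Qed.
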